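(* Let $E$, $F$ and $G$ be three normed vector spaces. Let $U$ be a subset of $E$ and $V$ be a subset of $F$. Let $\gamma>1$. Assume that $(E^{\otimes k})_{k\geq1}$ and $(F^{\otimes k})_{k\geq1}$ are endowed with norms satisfying the projective property. Let $f:U\to F$ and $g:V\to G$ be two $\mathrm{Lip}-\gamma$ maps such that $f(U)\subseteq V$. Then $g\circ f$ (endowed with its successive chain rule derivatives up to order $\lfloor\gamma\rfloor$) is $\mathrm{Lip}-\gamma$ and there exists a constant $C_\gamma$, depending only on $\gamma$, such that $$\|g\circ f\|_{\mathrm{Lip}-\gamma}\leq C_\gamma\,\|g\|_{\mathrm{Lip}-\gamma}\,\max\left(\|f\|_{\mathrm{Lip}-\gamma}^{\gamma},1\right).$$
   Context: Notation. For a real number $\gamma>0$, $\lfloor\gamma\rfloor$ denotes the unique integer with $0<\gamma-\lfloor\gamma\rfloor\leq1$ (so $\lfloor\gamma\rfloor=\gamma-1$ when $\gamma$ is an integer). $E^{\otimes k}$ is the $k$-fold algebraic tensor power of $E$, with a fixed norm also denoted $\|\cdot\|$. $\mathcal{L}_s(E^{\otimes k},F)$ is the space of symmetric $k$-linear mappings from $E$ to $F$, seen as linear maps on $E^{\otimes k}$. Lipschitz maps. Let $n\geq0$ be an integer, $0<\varepsilon\leq1$, $U\subseteq E$ any subset, $f^0:U\to F$ and $f^k:U\to\mathcal{L}_s(E^{\otimes k},F)$ for $1\leq k\leq n$. The remainder of order $k$ ($0\leq k\leq n$) of $f=(f^0,\dots,f^n)$ is defined by $$f^k(x)(v)=\sum_{j=k}^n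 f^j(y)\Big(\frac{v\otimes(x-y)^{\otimes(j-k)}}{(j-k)!}\Big)+R_k(x,y)(v),\quad x,y\in U,\ v\in E^{\otimes k}.$$ $f$ is $\mathrm{Lip}-(n+\varepsilon)$ on $U$ if there is $M$ such that for all $0\leq k\leq n$, $x,y\in U$, $v_1,\dots,v_k\in E$: $\|f^k(x)(v_1\otimes\cdots\otimes v_k)\|\leq M\|v_1\otimes\cdots\otimes v_k\|$ and $\|R_k(x,y)(v_1\otimes\cdots\otimes v_k)\|\leq M\|x-y\|^{n+\varepsilon-k}\|v_1\otimes\cdots\otimes v_k\|$. The smallest such $M$ is $\|f\|_{\mathrm{Lip}-(n+\varepsilon)}$. One often says that $f^0$ is Lip, the maps $f^1,\dots,f^n$ being understood. Chain rule derivatives. With $n=\lfloor\gamma\rfloor$, for $1\leq k\leq n$, $x\in U$, $v\in E^{\otimes k}$, $$(g\circ f)^k(x)(v)=\sum_{j=1}^k\frac{g^j(f^0(x))}{j!}\sum_{\substack{1\leq i_1,\dots,i_j\leq n\\ i_1+\cdots+i_j=k}}\frac{f^{i_1}(x)\otimes\cdots\otimes f^{i_j}(x)}{i_1!\cdots i_j!}\Big(\sum_{\sigma\in\mathcal{S}_k}\sigma(v)\Big),$$ where $\sigma(x_1\otimes\cdots\otimes x_k)=x_{\sigma(1)}\otimes\cdots\otimes x_{\sigma(k)}$. Projective property. The norms on $(E^{\otimes k})_{k\geq1}$ satisfy the projective property if $\|a\otimes b\|\leq\|a\|\|b\|$ for all $a\in E^{\otimes p}$, $b\in E^{\otimes q}$.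 Standing assumption. The norms on the tensor powers of the base space $E$ satisfy $\|v\otimes\tilde v\|=\|v\|\|\tilde v\|$ for all $k$, $v\in E^{\otimes k}$, $\tilde v\in E$. *)

(* Defs.v *)
From HB Require Import structures.
From mathcomp Require Import all_boot all_order all_algebra.
From mathcomp Require Import perm generic_quotient ring_quotient freeg.
From mathcomp Require Import all_classical all_reals all_analysis.

Set Implicit Arguments.
Unset Strict Implicit.
Unset Printing Implicit Defensive.

Import Order.TTheory GRing.Theory Num.Theory.
Import numFieldNormedType.Exports.

Local Open Scope ring_scope.
Local Open Scope quotient_scope.
Local Open Scope classical_set_scope.

Definition tset (T : Type) (k : nat) (v : k.-tuple T) (i : 'I_k) (x : T) :
    k.-tuple T :=
  [tuple if m == i then x else tnth v m | m < k].

Definition multilinear (R : fieldType) (E W : lmodType R) (k : nat)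
    (phi : k.-tuple E -> W) : Prop :=
  forall (v : k.-tuple E) (i : 'I_k), linear (fun x : E => phi (tset v i x)).

(* The algebraic tensor power of order k of E: the free vector space on
   k.-tuple E, modulo the subspace spanned by the multilinearity relations. *)
Section TensorPower.
Variables (R : fieldType) (E : lmodType R) (k : nat).

Local Notation free := {freeg (k.-tuple E) / R}.
Local Notation gen v := (<< v >> : free).

Definition tensor_rel (z : free) : bool :=
  `[< forall S : {pred free}, submod_closed S ->
      (forall (v : k.-tuple E) (i : 'I_k) (a : R) (x y : E),
         gen (tset v i (a *: x + y))
           - (a *: gen (tset v i x) + gen (tset v i y)) \in S) ->
      z \in S >].

Lemma tensor_relP (z : free) :
  reflect (forall S : {pred free}, submod_closed S ->
      (forall (v : k.-tuple E) (i : 'I_k) (a : R) (x y : E),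
         gen (tset v i (a *: x + y))
           - (a *: gen (tset v i x) + gen (tset v i y)) \in S) ->
      z \in S) (z \in tensor_rel).
Proof. exact: asboolP. Qed.

Lemma tensor_rel_submod : submod_closed tensor_rel.
Proof.
split; first by apply/tensor_relP => S [].
move=> a x y /tensor_relP xS /tensor_relP yS; apply/tensor_relP => S SS Sg.
by apply: SS.2; [exact: xS | exact: yS].
Qed.

Lemma tensor_rel_zmod : zmod_closed tensor_rel.
Proof. exact: GRing.submod_closedB tensor_rel_submod. Qed.

HB.instance Definition _ := GRing.isZmodClosed.Build free tensor_rel
  tensor_rel_zmod.

Definition tpow : Type := Quotient.quot (GRing.ZmodClosed.clone free tensor_rel _).

HB.instance Definition _ := GRing.Zmodule.on tpow.
HB.instance Definition _ := EqQuotient.on tpow.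

Definition tpi (x : free) : tpow := \pi_tpow x.

Lemma tpi_eqP (x y : free) : reflect (tpi x = tpi y) (x - y \in tensor_rel).
Proof. by rewrite [_ \in _]Quotient.idealrBE; apply: eqP. Qed.

Lemma reprK_tpi (t : tpow) : tpi (repr t) = t.
Proof. exact: reprK. Qed.

Lemma tpow_surj (t : tpow) : exists x : free, t = tpi x.
Proof. by exists (repr t); rewrite reprK_tpi. Qed.

Definition tscale (a : R) (t : tpow) : tpow := tpi (a *: repr t).

Lemma tpi_tscale (a : R) (x : free) : tscale a (tpi x) = tpi (a *: x).
Proof.
apply/tpi_eqP; rewrite -scalerBr.
have [r0 rP] := tensor_rel_submod.
rewrite -[_ *: _]addr0; apply: rP; last exact: r0.
by apply/tpi_eqP; rewrite reprK_tpi.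
Qed.

Lemma tpiD (x y : free) : tpi (x + y) = tpi x + tpi y.
Proof. exact: Quotient.pi_add. Qed.

Lemma tscaleA a b t : tscale a (tscale b t) = tscale (a * b) t.
Proof. by have [x ->] := tpow_surj t; rewrite !tpi_tscale scalerA. Qed.

Lemma tscale1 : left_id 1 tscale.
Proof. by move=> t; have [x ->] := tpow_surj t; rewrite tpi_tscale scale1r. Qed.

Lemma tscaleDr : right_distributive tscale +%R.
Proof.
move=> a t u; have [x ->] := tpow_surj t; have [y ->] := tpow_surj u.
by rewrite -tpiD !tpi_tscale scalerDr tpiD.
Qed.

Lemma tscaleDl t : {morph tscale^~ t : a b / a + b}.
Proof.
by move=> a b; have [x ->] := tpow_surj t; rewrite !tpi_tscale scalerDl tpiD.
Qed.

HB.instance Definition _ := GRing.Zmodule_isLmodule.Build R tpow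
  tscaleA tscale1 tscaleDr tscaleDl.

Lemma tpiZ (a : R) (x : free) : tpi (a *: x) = a *: tpi x.
Proof. by rewrite -tpi_tscale. Qed.

Lemma tpi_linear : linear tpi.
Proof. by move=> a x y; rewrite tpiD tpiZ. Qed.

Definition pure (v : k.-tuple E) : tpow := tpi (gen v).

(* Meaningful for multilinear phi, where it is the linear factorization of phi
   through pure, see tlift_linear and tlift_pure. *)
Definition tlift (W : lmodType R) (phi : k.-tuple E -> W) (t : tpow) : W :=
  fglift phi (repr t).

End TensorPower.

Section TensorPowerTheory.
Variables (R : fieldType) (E : lmodType R) (k : nat).
Local Notation free := {freeg (k.-tuple E) / R}.

Lemma pure_multilinear : multilinear (@pure R E k).
Proof.
move=> v i a x y; rewrite /pure -tpi_linear.
by apply/tpi_eqP/tensor_relP => S _; apply.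
Qed.

Lemma fglift_linear (W : lmodType R) (phi : k.-tuple E -> W) :
  linear (fglift phi : free -> W).
Proof.
have addP := lift_is_additive phi.
have fD x y : fglift phi (x + y : free) = fglift phi x + fglift phi y.
  rewrite -[in LHS](opprK y) addP -[- y]sub0r addP.
  have -> : fglift phi (0 : free) = 0 by rewrite -(subrr (0 : free)) addP subrr.
  by rewrite sub0r opprK.
move=> a x y; rewrite fD; congr (_ + _).
elim/freeg_ind_dom0: x => [|c v x _ _ IH].
  by rewrite scaler0 -(subrr (0 : free)) addP subrr scaler0.
rewrite scalerDr !fD scalerDr IH; congr (_ + _).
have -> : a *: (<< c *g v >> : free) = << (a * c) *g v >>.
  by apply/eqP/freeg_eqP => z; rewrite coeffZ !coeffU mulrA.
by rewrite !liftU scalerA.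
Qed.

Lemma tensor_rel_fglift (W : lmodType R) (phi : k.-tuple E -> W) (z : free) :
  multilinear phi -> z \in @tensor_rel R E k -> fglift phi z = 0.
Proof.
move=> phiP /tensor_relP /(_ [pred z | fglift phi z == 0]).
have fP := fglift_linear phi.
have f0 : fglift phi (0 : free) = 0.
  by have := fP (-1) 0 0; rewrite scaler0 addr0 scaleN1r addNr.
move=> zP; apply/eqP; apply: zP.
  split=> [|a x y]; rewrite ?unfold_in /= ?f0 // => /eqP x0 /eqP y0.
  by rewrite fP x0 y0 scaler0 addr0.
move=> v i a x y; rewrite unfold_in /= addrC -scaleN1r !fP !liftU !scale1r.
by rewrite phiP scaleN1r addNr.
Qed.

Lemma tlift_tpi (W : lmodType R) (phi : k.-tuple E -> W) (z : free) :
  multilinear phi -> tlift phi (tpi z) = fglift phi z.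
Proof.
move=> phiP; apply/eqP; rewrite -subr_eq0; apply/eqP.
have := @tensor_rel_fglift W phi (repr (tpi z) - z) phiP.
rewrite (lift_is_additive phi); apply; apply/tpi_eqP.
by rewrite reprK_tpi.
Qed.

Lemma tlift_pure (W : lmodType R) (phi : k.-tuple E -> W) (v : k.-tuple E) :
  multilinear phi -> tlift phi (pure v) = phi v.
Proof. by move=> phiP; rewrite tlift_tpi // liftU scale1r. Qed.

Lemma tlift_linear (W : lmodType R) (phi : k.-tuple E -> W) :
  multilinear phi -> linear (tlift phi).
Proof.
move=> phiP a t u; have [x ->] := tpow_surj t; have [y ->] := tpow_surj u.
rewrite -tpi_linear !tlift_tpi //.
exact: fglift_linear.
Qed.

Lemma pure_span (W : lmodType R) (p q : tpow E k -> W) :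
  linear p -> linear q -> (forall v, p (pure v) = q (pure v)) -> p =1 q.
Proof.
move=> pP qP pq t; have [x ->] := tpow_surj t.
have p0 : p 0 = 0 by have := pP (-1) 0 0; rewrite scaler0 addr0 scaleN1r addNr.
have q0 : q 0 = 0 by have := qP (-1) 0 0; rewrite scaler0 addr0 scaleN1r addNr.
have pi0 : tpi (0 : free) = 0.
  by have := tpi_linear (-1) (0 : free) 0; rewrite scaler0 addr0 scaleN1r addNr.
elim/freeg_ind_dom0: x => [|c v x _ _ IH]; first by rewrite pi0 p0 q0.
have -> : (<< c *g v >> : free) = c *: << v >>.
  by apply/eqP/freeg_eqP => z; rewrite coeffZ !coeffU mulrA mulr1.
by rewrite tpi_linear pP qP pq IH.
Qed.

End TensorPowerTheory.

Arguments tset : simpl never.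

Lemma nth_tset (T : Type) (x0 : T) (k : nat) (v : k.-tuple T) (i : 'I_k)
    (x : T) (p : nat) :
  nth x0 (tset v i x) p = if p == i then x else nth x0 v p.
Proof.
have [pk|kp] := ltnP p k.
  by rewrite -[p]/(val (Ordinal pk)) -tnth_nth tnth_mktuple val_eqE -tnth_nth.
rewrite !nth_default ?size_tuple //.
by case: eqP => // pi; move: (ltn_ord i); rewrite -pi ltnNge kp.
Qed.

Lemma tuple_ext (T : Type) (x0 : T) (k : nat) (s t : k.-tuple T) :
  (forall m, nth x0 s m = nth x0 t m) -> s = t.
Proof. by move=> st; apply: eq_from_tnth => m; rewrite !(tnth_nth x0). Qed.

Section TensorOperations.
Variables (R : fieldType) (E F : lmodType R).

Definition tmul (p q : nat) (a : tpow E p) (b : tpow E q) : tpow E (p + q) :=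
  tlift (fun u : p.-tuple E =>
    tlift (fun w : q.-tuple E => pure [tuple of u ++ w]) b) a.

Definition texp (x : E) (m : nat) : tpow E m := pure [tuple of nseq m x].

Definition tpermute (k : nat) (s : 'S_k) : tpow E k -> tpow E k :=
  tlift (fun v : k.-tuple E => pure [tuple tnth v (s i) | i < k]).

Definition offset (j : nat) (d : 'I_j -> nat) (l : nat) : nat :=
  \sum_(l' < j | (l' < l)%N) d l'.

Definition block (k j : nat) (d : 'I_j -> nat) (v : k.-tuple E) (l : 'I_j) :
    (d l).-tuple E :=
  [tuple nth 0 v (offset d l + m) | m < d l].

(* The tensor product h_0 (x) ... (x) h_(j-1) of linear maps, under the
   assumption that the d l add up to k. *)
Definition tprod (k j : nat) (d : 'I_j -> nat)
    (h : forall l : 'I_j, tpow E (d l) -> F) : tpow E k -> tpow F j :=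
  tlift (fun v : k.-tuple E => pure [tuple h l (pure (block d v l)) | l < j]).

Lemma tmul_pure (p q : nat) (u : p.-tuple E) (w : q.-tuple E) :
  tmul (pure u) (pure w) = pure [tuple of u ++ w].
Proof.
have wP (u' : p.-tuple E) :
    multilinear (fun w : q.-tuple E => pure [tuple of u' ++ w]).
  move=> v i a x y.
  have catE z : [tuple of u' ++ tset v i z]
      = tset [tuple of u' ++ v] (rshift p i) z.
    apply: (tuple_ext (x0 := 0)) => m.
    rewrite nth_tset /= !nth_cat ?nth_tset !size_tuple ?card_ord.
    case: ltnP => mp; first by rewrite ifN // neq_ltn ltn_addr.
    by rewrite -(eqn_add2l p) subnKC.
  by rewrite !catE pure_multilinear.
rewrite /tmul (_ : (fun _ => _) = fun u : p.-tuple E => pure [tuple of u ++ w]).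
  rewrite tlift_pure // => v i a x y.
  have catE z : [tuple of tset v i z ++ w]
      = tset [tuple of v ++ w] (lshift q i) z.
    apply: (tuple_ext (x0 := 0)) => m.
    rewrite nth_tset /= !nth_cat ?nth_tset !size_tuple ?card_ord.
    case: ltnP => // mp.
    by rewrite ifN // neq_ltn (leq_trans (ltn_ord i) mp) orbT.
  by rewrite !catE pure_multilinear.
by apply/funext => u'; rewrite tlift_pure.
Qed.

Lemma tpermute_pure (k : nat) (s : 'S_k) (v : k.-tuple E) :
  tpermute s (pure v) = pure [tuple tnth v (s i) | i < k].
Proof.
rewrite /tpermute tlift_pure // => {}v i a x y.
have setE z : [tuple tnth (tset v i z) (s m) | m < k]
    = tset [tuple tnth v (s m) | m < k] (s^-1 i)%g z.
  apply: eq_from_tnth => m; rewrite !tnth_mktuple.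
  by rewrite (canF_eq (permK s)).
by rewrite !setE pure_multilinear.
Qed.

Lemma tprod_pure (k j : nat) (d : 'I_j -> nat)
    (h : forall l : 'I_j, tpow E (d l) -> F) (v : k.-tuple E) :
  (\sum_l d l)%N = k -> (forall l, linear (h l)) ->
  tprod h (pure v) = pure [tuple h l (pure (block d v l)) | l < j].
Proof.
move=> dk hP; rewrite /tprod tlift_pure // => {}v i a x y.
have offS (l : 'I_j) : offset d l.+1 = (offset d l + d l)%N.
  rewrite /offset (bigD1 l) //= addnC; congr (_ + _)%N; apply: eq_bigl => l'.
  by rewrite ltnS ltn_neqAle andbC.
have offM m n : (m <= n)%N -> (offset d m <= offset d n)%N.
  move=> mn; rewrite /offset [leqRHS](bigID (fun l : 'I_j => (l < m)%N)) /=.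
  apply: leq_trans (leq_addr _ _); apply: eq_leq; apply: eq_bigl => l.
  by case: (ltnP l m) => [lm|]; rewrite ?andbF // (leq_trans lm mn).
have [l0 /andP[l1 l2]] : exists l : 'I_j, (offset d l <= i < offset d l.+1)%N.
  have ex : exists m, (i < offset d m)%N.
    exists j; rewrite /offset (eq_bigl predT) => [|l]; last by rewrite ltn_ord.
    by rewrite dk.
  case: (ex_minnP ex) => -[|m] im mP.
    by move: im; rewrite /offset big_pred0.
  have mj : (m < j)%N.
    rewrite ltnNge; apply/negP => jm.
    suff /mP : (i < offset d m)%N by rewrite ltnn.
    rewrite /offset (eq_bigl predT) ?dk // => l.
    exact: leq_trans (ltn_ord l) jm.
  exists (Ordinal mj) => /=; rewrite im andbT leqNgt; apply/negP => /mP.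
  by rewrite ltnn.
have i0P : (i - offset d l0 < d l0)%N by rewrite ltn_subLR // -offS.
pose i0 := Ordinal i0P.
have blockE z (l : 'I_j) : l != l0 -> block d (tset v i z) l = block d v l.
  move=> ll0; apply: eq_from_tnth => m; rewrite !tnth_mktuple nth_tset.
  case: eqP => // mi; exfalso; move: ll0; rewrite neq_ltn => /orP[] ll.
    have := leq_trans (offM _ _ ll) l1.
    by rewrite -mi offS leqNgt ltn_add2l ltn_ord.
  have := leq_trans l2 (offM _ _ ll).
  by rewrite -mi ltnNge leq_addr.
have block0E z : block d (tset v i z) l0 = tset (block d v l0) i0 z.
  apply: eq_from_tnth => m; rewrite !tnth_mktuple nth_tset -val_eqE /=.
  by rewrite -[in RHS](eqn_add2l (offset d l0)) subnKC.
have hE z : [tuple h l (pure (block d (tset v i z) l)) | l < j]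
    = tset [tuple h l (pure (block d v l)) | l < j] l0
        (h l0 (pure (tset (block d v l0) i0 z))).
  apply: eq_from_tnth => l; rewrite !tnth_mktuple.
  by case: eqP => [->|/eqP ll0]; [rewrite block0E | rewrite blockE].
by rewrite !hE pure_multilinear hP pure_multilinear.
Qed.

End TensorOperations.

Record tensor_norms (R : realType) (E : normedModType R) := TensorNorms {
  tnorm :> forall k : nat, tpow E k -> R;
  tnorm_triangle : forall k (t u : tpow E k),
    tnorm (t + u) <= tnorm t + tnorm u;
  tnormZ : forall k (a : R) (t : tpow E k), tnorm (a *: t) = `|a| * tnorm t;
  tnorm_definite : forall k (t : tpow E k), tnorm t = 0 -> t = 0;
  tnorm_scalar : tnorm (pure [tuple of [::]]) = 1;
  tnorm_vector : forall x : E, tnorm (pure [tuple x]) = `|x| }.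

Definition projective (R : realType) (E : normedModType R)
    (N : tensor_norms E) : Prop :=
  forall (p q : nat) (a : tpow E p) (b : tpow E q), (0 < p)%N -> (0 < q)%N ->
    N (p + q)%N (tmul a b) <= N p a * N q b.

Definition cross_norm (R : realType) (E : normedModType R)
    (N : tensor_norms E) : Prop :=
  forall (k : nat) (v : tpow E k) (w : E),
    N (k + 1)%N (tmul v (pure [tuple w])) = N k v * `|w|.

(* Not the usual floor: gamma - 1 when gamma is an integer. *)
Definition lipfloor (R : realType) (gamma : R) : nat :=
  `|Num.ceil gamma|%N.-1.

Lemma lipfloorP (R : realType) (gamma : R) : 0 < gamma ->
  0 < gamma - (lipfloor gamma)%:R <= 1.
Proof.
move=> g0; have c0 : 0 < Num.ceil gamma by rewrite ceil_gt0.
have -> : (lipfloor gamma)%:R = (Num.ceil gamma - 1)%:~R :> R.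
  rewrite /lipfloor; case: (Num.ceil gamma) c0 => [[|n]|n] // _.
  by rewrite rmorphB /= -[RHS]/(n.+1%:R - 1) -natr1 addrK.
have /andP[lt_c le_c] := ceil_itv gamma; rewrite subr_gt0 lt_c /=.
by rewrite rmorphB /= opprB addrCA gerDl subr_le0.
Qed.

(* f k x is f^k(x), seen as a map on the tensor power of order k. Since the
   tensor power of order 0 is R, f^0(x) is seen as r |-> r f^0(x); its value
   as a vector is jet0 f x. Only the points x of the domain and the orders
   k <= lipfloor gamma matter. *)
Definition jet (R : realType) (E F : normedModType R) :=
  forall k : nat, E -> tpow E k -> F.

Definition jet0 (R : realType) (E F : normedModType R) (f : jet E F) (x : E)
    : F :=
  f 0%N x (pure [tuple of [::]]).

Definition symmetric_linear (R : realType) (E F : normedModType R) (k : nat)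
    (phi : tpow E k -> F) : Prop :=
  linear phi /\ forall (s : 'S_k) (v : tpow E k), phi (tpermute s v) = phi v.

Section Lipschitz.
Variables (R : realType) (E F : normedModType R).

(* The summation index is m = j - k. *)
Definition remainder (n : nat) (f : jet E F) (k : nat) (x y : E)
    (v : tpow E k) : F :=
  f k x v - \sum_(0 <= m < (n - k).+1)
              f (k + m)%N y (m`!%:R^-1 *: tmul v (texp (x - y) m)).

Definition lip_bound (gamma : R) (N : tensor_norms E) (U : set E)
    (f : jet E F) (M : R) : Prop :=
  forall (k : nat), (k <= lipfloor gamma)%N ->
  forall (x y : E), U x -> U y -> forall v : k.-tuple E,
    `|f k x (pure v)| <= M * N k (pure v) /\
    `|remainder (lipfloor gamma) f x y (pure v)|
      <= M * `|x - y| `^ (gamma - k%:R) * N k (pure v).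

Definition is_lip (gamma : R) (N : tensor_norms E) (U : set E) (f : jet E F)
    : Prop :=
  (forall (k : nat) (x : E), (k <= lipfloor gamma)%N -> U x ->
     symmetric_linear (f k x)) /\
  exists M : R, 0 <= M /\ lip_bound gamma N U f M.

(* The infimum is attained as soon as the set is nonempty. *)
Definition lip_norm (gamma : R) (N : tensor_norms E) (U : set E)
    (f : jet E F) : R :=
  inf [set M : R | 0 <= M /\ lip_bound gamma N U f M].

End Lipschitz.

Definition jet_comp (R : realType) (E F G : normedModType R) (n : nat)
    (g : jet F G) (f : jet E F) : jet E G := fun k =>
  match k return E -> tpow E k -> G with
  | 0%N => fun x => tlift (fun _ : 0.-tuple E => jet0 g (jet0 f x))
  | k'.+1 => fun x v =>
      \sum_(1 <= j < k'.+2) j`!%:R^-1 *: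
        g j (jet0 f x)
          (\sum_(i : {ffun 'I_j -> 'I_n.+1} |
                 [forall l, (0 < i l)%N] && ((\sum_l i l)%N == k'.+1))
             (\prod_l (i l)`!%:R)^-1 *:
               tprod (d := fun l => i l) (fun l => f (i l) x)
                 (\sum_(s : 'S_k'.+1) tpermute s v))
  end.

Lemma jet0_comp (R : realType) (E F G : normedModType R) (n : nat)
    (g : jet F G) (f : jet E F) (x : E) :
  jet0 (jet_comp n g f) x = jet0 g (jet0 f x).
Proof. by rewrite {1}/jet0 /= tlift_pure // => v []. Qed.

(* Main.v *)
Require Import Defs.
From HB Require Import structures.
From mathcomp Require Import all_boot all_order all_algebra.
From mathcomp Require Import perm.
From mathcomp Require Import all_classical all_reals all_analysis.
From mathcomp Require Import ring lra.

Set Implicit Arguments.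
Unset Strict Implicit.
Unset Printing Implicit Defensive.

Import Order.TTheory GRing.Theory Num.Theory.
Import numFieldNormedType.Exports.

Local Open Scope classical_set_scope.
Local Open Scope ring_scope.

(* A jet is bounded and Taylor-expandable as soon as its values on the diagonals
   z (x) ... (x) z are: with T_x(z) = sum_k f^k(x)(z^k)/k!, the binomial formula
   gives T_x(z) - T_y(z + x - y) = sum_k R_k(x,y)(z^k)/k!, so a bound C r^gamma
   of the left side for |z| <= r = |x - y| bounds each R_k(x,y)(z^k), as a
   coefficient of a polynomial in z, and polarization then bounds R_k(x,y).
   The chain rule says that T_x for g o f is the truncation at degree n of
   T^g_(f x)(T^f_x(z) - f x), so no combinatorics is needed: for r <= 1 the
   increment of this composition is controlled by the remainders of f and of g,
   and the discarded terms are O(r^(n+1)). For r > 1 bounding every term of the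
   remainder separately suffices. *)

(** * Symmetric multilinear maps on sequences *)

(** The Lipschitz conditions only test pure tensors, so the jet at a point can be handled as a
    function on lists: all orders then share one type, and concatenation needs no transport between
    tensor powers. The cross norm on [E] makes the norm of a pure tensor equal to the product of the
    norms of its factors, so a bound by this product is what has to be proved for the composition.
    On [F] the projective property bounds the norm by the product, which is enough because the norms
    on [F] enter only through the bounds assumed on [g]. The obstacle is that the chain rule on a
    general pure tensor mixes permutations with cuttings into blocks; diagonals erase both, at the
    price of recovering the other arguments by polarization. The constants of coefficient extraction
    and polarization are chosen before the spaces, which is what makes the final constant depend on
    [gamma] alone. The power gamma of the norm of [f] has one genuine source, the remainder of [g]
    at two points whose distance is of size O(M r); the other terms contain at most max(M, 1)^n. *)

(* Only the values of J on sequences of size k matter; symmetry allows linearity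
   to be required in the first argument alone. *)
Definition sym_multilinear (R : fieldType) (E F : lmodType R) (k : nat)
    (J : seq E -> F) : Prop :=
  (forall s t, size s = k -> perm_eq s t -> J s = J t) /\
  (forall s, (size s).+1 = k -> linear (fun x => J (x :: s))).

Section SymMultilinear.
Variables (R : fieldType) (E F : lmodType R).
Implicit Types (J : seq E -> F) (s t u : seq E).

Lemma sym_multilinear_perm k J s t :
  sym_multilinear k J -> size s = k -> perm_eq s t -> J s = J t.
Proof. by case=> + _; apply. Qed.

Lemma sym_multilinearD k J s x y : sym_multilinear k J -> (size s).+1 = k ->
  J (x + y :: s) = J (x :: s) + J (y :: s).
Proof. by move=> [_ JP] sk; have := JP s sk 1 x y; rewrite !scale1r. Qed.

Lemma sym_multilinear0 k J s : sym_multilinear k J -> (size s).+1 = k ->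
  J (0 :: s) = 0.
Proof.
move=> JP sk; have := sym_multilinearD 0 0 JP sk.
by rewrite addr0 -[LHS]addr0 => /addrI.
Qed.

Lemma sym_multilinearZ k J s a x : sym_multilinear k J -> (size s).+1 = k ->
  J (a *: x :: s) = a *: J (x :: s).
Proof.
move=> JP sk; have [_ /(_ s sk a x 0)] := JP.
by rewrite !addr0 (sym_multilinear0 JP) // addr0.
Qed.

Lemma sym_multilinearB k J s x y : sym_multilinear k J -> (size s).+1 = k ->
  J (x - y :: s) = J (x :: s) - J (y :: s).
Proof.
move=> JP sk; rewrite (sym_multilinearD _ _ JP sk) -scaleN1r.
by rewrite (sym_multilinearZ _ _ JP sk) scaleN1r.
Qed.

Lemma sym_multilinear_sum k J s I (r : seq I) (P : pred I) (x : I -> E) :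
  sym_multilinear k J -> (size s).+1 = k ->
  J (\sum_(i <- r | P i) x i :: s) = \sum_(i <- r | P i) J (x i :: s).
Proof.
move=> JP sk; apply: (big_morph (fun z => J (z :: s))).
  by move=> z w; apply: sym_multilinearD JP sk.
exact: sym_multilinear0 JP sk.
Qed.

Lemma sym_multilinear_rot k J s x u :
  sym_multilinear k J -> (size s + size u).+1 = k ->
  J (s ++ x :: u) = J (x :: s ++ u).
Proof.
move=> JP sk; apply: (sym_multilinear_perm JP).
  by rewrite size_cat /= addnS.
by rewrite perm_sym -cat1s perm_catCA.
Qed.

Lemma sym_multilinear_scale k J I (r : seq I) (c : I -> R) (x : I -> E) u :
  sym_multilinear k J -> (size r + size u)%N = k ->
  J ([seq c i *: x i | i <- r] ++ u)
    = (\prod_(i <- r) c i) *: J ([seq x i | i <- r] ++ u).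
Proof.
move=> JP; elim: r u => [|i r IH] u /= rk; first by rewrite big_nil scale1r.
rewrite (sym_multilinearZ _ _ JP) ?size_cat ?size_map //.
rewrite -[X in c i *: X](sym_multilinear_rot _ JP) ?size_map //.
rewrite IH /= ?addnS // (sym_multilinear_rot _ JP) ?size_map //.
by rewrite big_cons scalerA.
Qed.

(** Induction on [q] with [u] arbitrary: splitting one copy of [z + h] moves [z] or [h] into [u],
    and Pascal's rule merges the two sums. *)
Lemma sym_multilinear_binomial J q u z h :
  sym_multilinear (q + size u) J ->
  J (nseq q (z + h) ++ u)
    = \sum_(m < q.+1) J (nseq (q - m) z ++ nseq m h ++ u) *+ 'C(q, m).
Proof.
elim: q u => [|q IH] u JP; first by rewrite big_ord_recl big_ord0 addr0.
rewrite /= (sym_multilinearD _ _ JP) ?size_cat ?size_nseq //.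
rewrite -!(sym_multilinear_rot _ JP) ?size_nseq //.
rewrite !IH /= ?addnS //.
pose a m := J (nseq (q.+1 - m) z ++ nseq m h ++ u).
have IHz : \sum_(m < q.+1) J (nseq (q - m) z ++ nseq m h ++ z :: u) *+ 'C(q, m)
    = \sum_(m < q.+2) a m *+ 'C(q, m).
  rewrite [in RHS]big_ord_recr /= bin_small // mulr0n addr0; apply: eq_bigr => -[m mq] _.
  rewrite /a subSn //= [in LHS]catA [in RHS]catA (sym_multilinear_rot _ JP) //.
  by rewrite size_cat !size_nseq subnK.
have IHh : \sum_(m < q.+1) J (nseq (q - m) z ++ nseq m h ++ h :: u) *+ 'C(q, m)
    = \sum_(m < q.+1) a m.+1 *+ 'C(q, m).
  apply: eq_bigr => -[m mq] _ /=; congr (_ *+ _); rewrite /a subSS.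
  by congr (J (_ ++ _)); elim: (m) => //= p ->.
rewrite IHz IHh -[RHS]/(\sum_(m < q.+2) a m *+ 'C(q.+1, m)).
rewrite big_ord_recl [in RHS]big_ord_recl -addrA -big_split.
congr (_ + _); first by rewrite !bin0.
by apply: eq_bigr => m _; rewrite lift0 binS mulrnDr.
Qed.

End SymMultilinear.

(** Both sides run over the pairs with sum at most [n]; passing to [n.+1] adds one antidiagonal. *)
Lemma big_triangle (V : nmodType) (F : nat -> nat -> V) n :
  \sum_(q < n.+1) \sum_(m < q.+1) F (q - m)%N m
    = \sum_(k < n.+1) \sum_(m < (n - k).+1) F k m.
Proof.
elim: n => [|n IH]; first by rewrite !big_ord1.
rewrite big_ord_recr IH [in RHS]big_ord_recr /= subnn big_ord1.
have -> : \sum_(k < n.+1) \sum_(m < (n.+1 - k).+1) F k m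
    = \sum_(k < n.+1) (\sum_(m < (n - k).+1) F k m + F k (n - k).+1).
  by apply: eq_bigr => k _; rewrite subSn ?leq_ord // big_ord_recr.
rewrite big_split -addrA; congr (_ + _); rewrite big_ord_recl addrC subn0.
congr (_ + _); rewrite (reindex_inj rev_ord_inj) /=; apply: eq_bigr => k _.
by rewrite /bump add1n !subSS subKn ?leq_ord.
Qed.

(** * Taylor polynomials and bounds on polynomial coefficients *)

Section Taylor.
Variables (R : numFieldType) (E F : lmodType R).
Implicit Types (J : seq E -> F).

Definition taylor n J (z : E) : F := \sum_(k < n.+1) k`!%:R^-1 *: J (nseq k z).

(** With [J] and [J'] the jets at x and y and [h] = x - y, this is the remainder R_k(x,y) for k =
    [size s]. *)
Definition seq_remainder n J J' (h : E) (s : seq E) : F :=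
  J s - \sum_(m < (n - size s).+1) m`!%:R^-1 *: J' (s ++ nseq m h).

Lemma taylor_seq_remainder n J J' z h :
  (forall k, (k <= n)%N -> sym_multilinear k J') ->
  taylor n J z - taylor n J' (z + h)
    = \sum_(k < n.+1) k`!%:R^-1 *: seq_remainder n J J' h (nseq k z).
Proof.
move=> JP; under [RHS]eq_bigr => k _ do rewrite scalerBr size_nseq.
rewrite sumrB; congr (_ - _).
under [RHS]eq_bigr do rewrite scaler_sumr.
rewrite -(big_triangle (fun k m =>
  k`!%:R^-1 *: (m`!%:R^-1 *: J' (nseq k z ++ nseq m h)))).
apply: eq_bigr => -[q qn] _ /=; have := @sym_multilinear_binomial _ _ _ J' q [::].
move=> /(_ z h); rewrite cats0 addn0 => ->; last exact: JP.
rewrite scaler_sumr; apply: eq_bigr => -[m mq] _ /=; rewrite cats0.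
rewrite -[X in _ *: X = _]scaler_nat !scalerA; congr (_ *: _).
have /(congr1 (fun n => n%:R : R)) := bin_fact (n := q) (m := m) mq.
rewrite !natrM => <-; rewrite !invfM mulrAC mulVf ?mul1r 1?mulrC //.
by rewrite pnatr_eq0 -lt0n bin_gt0.
Qed.

End Taylor.

(* Q(t) - 2^n Q(t/2) has no term of degree n, hence the induction. *)
Lemma bounded_coef (R : realType) (n : nat) : exists2 C : R, 0 <= C &
  forall (V : normedModType R) (c : nat -> V) (K : R),
    (forall t : R, 0 <= t <= 1 -> `|\sum_(k < n.+1) t ^+ k *: c k| <= K) ->
    forall k, (k <= n)%N -> `|c k| <= C * K.
Proof.
elim: n => [|n [C C0 IH]].
  exists 1 => // V c K /(_ 1); rewrite ler01 lexx => /(_ isT) cK [|//] _.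
  by move: cK; rewrite big_ord1 expr0 scale1r mul1r.
have pow2 : 1 <= 2 ^+ n.+1 :> R by rewrite exprn_ege1 // ler1n.
pose D : R := C * (1 + 2 ^+ n.+1); have D0 : 0 <= D by rewrite mulr_ge0 //; lra.
exists (1 + n.+1%:R * D + D) => [|V c K cK].
  by rewrite !addr_ge0 ?mulr_ge0.
have K0 : 0 <= K by apply: le_trans (normr_ge0 _) (cK 0 _); rewrite lexx ler01.
have low k : (k <= n)%N -> `|c k| <= D * K.
  (* These are the coefficients of Q(t) - 2^(n+1) Q(t/2). For k <= n the factor has absolute value
     at least 1, so a bound on [c'] is one on [c]. *)
  move=> kn; pose c' k := (1 - 2 ^+ (n.+1 - k)) *: c k.
  have := IH V c' ((1 + 2 ^+ n.+1) * K).
  have c'K t : 0 <= t <= 1 ->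
      `|\sum_(k < n.+1) t ^+ k *: c' k| <= (1 + 2 ^+ n.+1) * K.
    move=> /andP[t0 t1].
    have -> : \sum_(k < n.+1) t ^+ k *: c' k = \sum_(k < n.+2) t ^+ k *: c k
        - 2 ^+ n.+1 *: \sum_(k < n.+2) (t / 2) ^+ k *: c k.
      rewrite scaler_sumr -sumrB [in RHS]big_ord_recr /=.
      have -> : t ^+ n.+1 *: c n.+1 - 2 ^+ n.+1 *: ((t / 2) ^+ n.+1 *: c n.+1) = 0.
        by rewrite scalerA -exprMn mulrCA divff // mulr1 subrr.
      rewrite addr0; apply: eq_bigr => -[p pn] _ /=; rewrite /c' !scalerA -scalerBl.
      congr (_ *: _); have -> : 2 ^+ n.+1 = 2 ^+ (n.+1 - p) * 2 ^+ p :> R.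
        by rewrite -exprD subnK // ltnW.
      by rewrite -mulrA -exprMn mulrCA divff // mulr1; ring.
    apply: le_trans (ler_normB _ _) _; rewrite mulrDl mul1r normrZ lerD //.
      by apply: cK; rewrite t0.
    rewrite ger0_norm ?exprn_ge0 // ler_wpM2l ?exprn_ge0 //.
    by apply: cK; rewrite divr_ge0 //=; lra.
  move=> /(_ c'K k kn); rewrite /c' normrZ mulrA; apply: le_trans.
  rewrite ler_peMl //  distrC ger0_norm ?subr_ge0 ?exprn_ege1 ?ler1n //.
  by rewrite lerBrDr -[1 + 1]/(2%:R ^+ 1) ler_weXn2l ?ler1n // subn_gt0 ltnS.
move=> k; rewrite leq_eqVlt => /predU1P[->|]; last first.
  rewrite ltnS => /low /le_trans; apply; rewrite ler_wpM2r // lerDr.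
  by rewrite addr_ge0 ?mulr_ge0.
(* The leading coefficient is Q(1) minus the lower ones, already bounded. *)
have -> : c n.+1 = \sum_(k < n.+2) 1 ^+ k *: c k - \sum_(k < n.+1) 1 ^+ k *: c k.
  by rewrite [X in X - _]big_ord_recr /= expr1n scale1r addrAC subrr add0r.
apply: le_trans (ler_normB _ _) _; rewrite mulrDl (@le_trans _ _ (K + n.+1%:R * D * K)) //.
  apply: lerD; first by apply: cK; rewrite ler01 lexx.
  apply: le_trans (ler_norm_sum _ _ _) _; rewrite -mulrA.
  apply: (@le_trans _ _ (\sum_(k < n.+1) D * K)).
    by apply: ler_sum => -[p pn] _; rewrite expr1n scale1r low.
  by rewrite sumr_const card_ord mulr_natl.
by rewrite mulrDl mul1r lerDl mulr_ge0.
Qed.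

(** * Polarization of symmetric multilinear maps *)

Lemma unit_direction (R : realType) (E : normedModType R) (z : E) :
  exists2 z' : E, `|z'| <= 1 & z = `|z| *: z'.
Proof.
have [->|z0] := eqVneq z 0; first by exists 0; rewrite ?normr0 ?scaler0.
have nz : `|z| != 0 by rewrite normr_eq0.
exists (`|z|^-1 *: z); last by rewrite scalerA divff // scale1r.
by rewrite normrZ normfV normr_id mulVf.
Qed.

Section Polarization.
Variable R : realType.

Lemma sym_multilinear_nseqZ (E F : lmodType R) k m (J : seq E -> F) a z u :
  sym_multilinear k J -> (m + size u)%N = k ->
  J (nseq m (a *: z) ++ u) = a ^+ m *: J (nseq m z ++ u).
Proof.
move=> JP mk; have := sym_multilinear_scale (r := nseq m tt) (u := u)
  (fun=> a) (fun=> z) JP.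
rewrite size_nseq !map_nseq => -> //; congr (_ *: _).
by rewrite big_nseq iter_mulr_1.
Qed.

(** Scaling to the ball of radius [r]: this turns an estimate valid for |z| <= |x - y| into the
    factor |x - y|^(-k) that lowers the exponent from gamma to gamma - k. *)
Lemma sym_multilinear_homogeneous (E F : normedModType R) k (J : seq E -> F) r K :
  sym_multilinear k J -> 0 < r ->
  (forall z, `|z| <= r -> `|J (nseq k z)| <= K) ->
  forall z, `|J (nseq k z)| <= K / r ^+ k * `|z| ^+ k.
Proof.
move=> JP r0 JK z; have [z' z'1 zE] := unit_direction z.
have {}zE : z = (`|z| / r) *: (r *: z') by rewrite scalerA divfK ?gt_eqF.
have := sym_multilinear_nseqZ (`|z| / r) (r *: z') (m := k) (u := [::]) JP.
rewrite !cats0 addn0 -zE => -> //; rewrite normrZ normrX ger0_norm ?divr_ge0 ?(ltW r0) //.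
rewrite mulrC expr_div_n mulrA mulrAC ler_wpM2r ?exprn_ge0 //.
rewrite ler_wpM2r ?invr_ge0 ?exprn_ge0 ?(ltW r0) // JK //.
by rewrite normrZ gtr0_norm // ger_pMr.
Qed.

(* J(z^(q-1), h, u) is, up to the factor q, the coefficient of t in
   J((z + t h)^q, u), so vectors are freed from the diagonal one at a time. *)
Lemma polarization_bound k : exists2 C : R, 0 <= C &
  forall (E F : normedModType R) (J : seq E -> F) (K : R),
    sym_multilinear k J -> 0 <= K -> (forall z, `|J (nseq k z)| <= K * `|z| ^+ k) ->
    forall s, size s = k -> `|J s| <= C * K * \prod_(x <- s) `|x|.
Proof.
(* [p] counts the freed vectors, kept in the unit ball. The radius [D] must vary: [z + t *: h] lies
   in the ball of radius [2 * D], so each step costs a factor 2^k. *)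
have step p : (p <= k)%N -> exists2 C : R, 0 <= C &
    forall (E F : normedModType R) (J : seq E -> F) (K : R),
    sym_multilinear k J -> 0 <= K -> (forall z, `|J (nseq k z)| <= K * `|z| ^+ k) ->
    forall D z u, 1 <= D -> `|z| <= D -> size u = p ->
      (forall x, x \in u -> `|x| <= 1) ->
    `|J (nseq (k - p) z ++ u)| <= C * K * D ^+ k.
  elim: p => [_|p IH pk].
    exists 1 => // E F J K JP K0 JK D z [|//] D1 zD _ _.
    rewrite subn0 cats0 mul1r (le_trans (JK z)) //.
    by rewrite ler_wpM2l // lerXn2r ?nnegrE // (le_trans _ D1).
  have [C C0 {}IH] := IH (ltnW pk).
  have [B B0 coefP] := bounded_coef R (k - p).
  exists (B * C * 2 ^+ k) => [|E F J K JP K0 JK D z [//|h u] D1 zD /= [up] u1].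
    by rewrite !mulr_ge0 // exprn_ge0.
  pose c m := J (nseq (k - p - m) z ++ nseq m h ++ u) *+ 'C(k - p, m).
  have sz m : (m <= k - p)%N -> (m + size (nseq (k - p - m) z ++ u))%N = k.
    by move=> mp; rewrite size_cat size_nseq up addnA subnKC // subnK // ltnW.
  have : forall m, (m <= k - p)%N -> `|c m| <= B * (C * K * (2 * D) ^+ k).
    apply: coefP => t /andP[t0 t1].
    have -> : \sum_(m < (k - p).+1) t ^+ m *: c m
        = J (nseq (k - p) (z + t *: h) ++ u).
      rewrite sym_multilinear_binomial ?up ?subnK ?(ltnW pk) //.
      apply: eq_bigr => -[m mp] _ /=; rewrite /c -scalerMnr; congr (_ *+ _).
      have permE w : J (nseq (k - p - m) z ++ nseq m w ++ u)
          = J (nseq m w ++ nseq (k - p - m) z ++ u).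
        apply: (sym_multilinear_perm JP); last exact/permPl/perm_catCA.
        by rewrite catA size_cat size_cat !size_nseq subnK // up subnK // ltnW.
      by rewrite !permE (sym_multilinear_nseqZ _ _ JP) // sz.
    apply: IH => //; first by lra.
      apply: le_trans (ler_normD _ _) _; rewrite mulr_natl mulr2n lerD //.
      rewrite normrZ ger0_norm // (le_trans _ D1) // mulr_ile1 //.
      by rewrite u1 // mem_head.
    by move=> x xu; rewrite u1 // inE xu orbT.
  move=> /(_ 1%N); rewrite subn_gt0 pk => /(_ isT); rewrite /c bin1.
  rewrite subn1 -subnS exprMn /= -[J _]/(J (nseq (k - p.+1) z ++ h :: u)) => cB.
  apply: (@le_trans _ _ (`|J (nseq (k - p.+1) z ++ h :: u) *+ (k - p)|)).
    by rewrite normrMn -mulr_natl ler_peMl ?ler1n ?subn_gt0.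
  by apply: le_trans cB _; rewrite le_eqVlt -!mulrA !(mulrCA _ K) eqxx.
have [C C0 CP] := step k (leqnn k); exists C => // E F J K JP K0 JK s sk.
pose e x := sval (cid2 (unit_direction (x : E))).
have [e1 eE] : (forall x, `|e x| <= 1) /\ (forall x, x = `|x| *: e x).
  by split=> x; rewrite /e; case: cid2.
have sE : s = [seq `|x| *: e x | x <- s] ++ [::].
  by rewrite cats0 -[LHS]map_id; apply: eq_map => x; exact: eE.
rewrite [in J s]sE (sym_multilinear_scale _ _ JP) ?addn0 // cats0 normrZ.
rewrite ger0_norm ?prodr_ge0 // mulrC ler_wpM2r ?prodr_ge0 //.
(* All vectors are freed, so no copy of [z], taken to be 0, is left, and [D] is 1. *)
have := CP E F J K JP K0 JK 1 0 [seq e x | x <- s].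
rewrite subnn expr1n mulr1 size_map normr0; apply=> //.
by move=> _ /mapP[x _ ->].
Qed.

End Polarization.

(** As in the binomial formula, [u] receives the vectors already chosen. Indexing by functions
    matches the sums of the chain rule. *)
Lemma sym_multilinear_expand (R : fieldType) (E F : lmodType R) (J : seq E -> F)
    (I : finType) (P : pred I) (w : I -> E) j u :
  sym_multilinear (j + size u) J ->
  J (nseq j (\sum_(i | P i) w i) ++ u)
    = \sum_(i : {ffun 'I_j -> I} | [forall l, P (i l)])
        J ([seq w (i l) | l <- enum 'I_j] ++ u).
Proof.
elim: j u => [|j IH] u JP.
  rewrite [RHS](eq_bigl predT) => [|i]; last first.
    by have -> : [forall l, P (i l)] by apply/forallP => -[].
  rewrite [RHS](eq_bigr (fun=> J u)) => [|i _]; last first.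
    by rewrite (size0nil (_ : size (enum 'I_0) = 0%N)) ?size_enum_ord.
  by rewrite sumr_const card_ffun card_ord expn0.
rewrite /= (sym_multilinear_sum _ _ _ JP) ?size_cat ?size_nseq //.
pose cons_ffun (p : I * {ffun 'I_j -> I}) : {ffun 'I_j.+1 -> I} :=
  [ffun l => if unlift ord0 l is Some l' then p.2 l' else p.1].
have cons0 p : cons_ffun p ord0 = p.1 by rewrite ffunE unlift_none.
have consS p l : cons_ffun p (lift ord0 l) = p.2 l by rewrite ffunE liftK.
rewrite (reindex cons_ffun) /=; last first.
  exists (fun i : {ffun 'I_j.+1 -> I} => (i ord0, [ffun l => i (lift ord0 l)])).
    move=> [i0 i] _; rewrite cons0; congr (_, _); apply/ffunP => l.
    by rewrite ffunE consS.
  move=> i _; apply/ffunP => l; rewrite ffunE.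
  by case: unliftP => [l'|] -> //=; rewrite ffunE.
rewrite (eq_bigl (fun p : I * {ffun 'I_j -> I} => P p.1 && [forall l, P (p.2 l)])).
  rewrite -(pair_big P (fun i : {ffun 'I_j -> I} => [forall l, P (i l)])
    (fun i0 i => J ([seq w (cons_ffun (i0, i) l) | l <- enum 'I_j.+1] ++ u))) /=.
  apply: eq_bigr => i0 Pi0; rewrite -(sym_multilinear_rot _ JP) ?size_nseq //.
  rewrite IH /= ?addnS //; apply: eq_bigr => i _.
  rewrite enum_ordSl /= cons0 (sym_multilinear_rot _ JP).
    rewrite -map_comp; congr (J (_ :: _ ++ _)).
    by apply: eq_map => l /=; rewrite consS.
  by rewrite size_map size_enum_ord.
move=> [i0 i]; apply/forallP/andP => /= [Pi|[Pi0 /forallP Pi] l].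
  split; first by have := Pi ord0; rewrite cons0.
  by apply/forallP => l; have := Pi (lift ord0 l); rewrite consS.
by rewrite ffunE; case: unliftP => [l'|].
Qed.

(** Lets a remainder of order [k] at an increment of norm [b], applied to [k] copies of a vector of
    norm [c], be bounded by the same power for all [k]. *)
Lemma powR_split (R : realType) (gamma a b c : R) (k : nat) : k%:R < gamma ->
  0 <= b <= a -> 0 <= c <= a -> b `^ (gamma - k%:R) * c ^+ k <= a `^ gamma.
Proof.
move=> kg /andP[b0 ba] /andP[c0 ca]; have a0 : 0 <= a by apply: le_trans ba.
have g0 : 0 < gamma by apply: le_lt_trans kg.
have -> : a `^ gamma = a `^ (gamma - k%:R) * a ^+ k.
  by rewrite -powR_mulrn // -powRD subrK // gt_eqF.
rewrite ler_pM ?powR_ge0 ?exprn_ge0 //; last by rewrite lerXn2r ?nnegrE.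
by rewrite ge0_ler_powR ?nnegrE // subr_ge0 ltW.
Qed.

(** * Estimates for jets bounded up to a given order *)

Definition seq_bound (R : realType) (E F : normedModType R) (n : nat) (M : R)
    (J : seq E -> F) : Prop :=
  forall s, (size s <= n)%N -> `|J s| <= M * \prod_(x <- s) `|x|.

Lemma norm_inv_factZ (R : realType) (F : normedModType R) k (v : F) : `|k`!%:R^-1 *: v| <= `|v|.
Proof.
rewrite normrZ ler_piMl // ger0_norm ?invr_ge0 //.
by rewrite invf_le1 ?ltr0n ?fact_gt0 // ler1n fact_gt0.
Qed.

Section SeqBound.
Variables (R : realType) (E F : normedModType R) (n : nat) (M : R).
Variable (J : seq E -> F).
Hypotheses (M0 : 0 <= M) (JM : seq_bound n M J).

Lemma seq_bound_nseq k z : (k <= n)%N -> `|J (nseq k z)| <= M * `|z| ^+ k.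
Proof.
by move=> kn; have := JM (s := nseq k z); rewrite size_nseq big_nseq iter_mulr_1 => ->.
Qed.

(** The Taylor polynomial without its constant term, written as a sum so that
    [sym_multilinear_expand] applies to it. *)
Definition taylor_tail (z : E) : F :=
  \sum_(i < n.+1 | (0 < i)%N) i`!%:R^-1 *: J (nseq i z).

Lemma taylor_tailE z : taylor n J z = J [::] + taylor_tail z.
Proof.
rewrite /taylor /taylor_tail big_ord_recl fact0 invr1 scale1r; congr (_ + _).
by rewrite [RHS]big_mkcond [RHS]big_ord_recl /= add0r.
Qed.

(** Every term has positive degree, so [r <= 1] leaves one factor [r]. The radius [2 * r]
    accommodates [z + h] with [z] and [h] of norm at most [r]. *)
Lemma taylor_tail_bound z r : 0 <= r <= 1 -> `|z| <= 2 * r ->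
  `|taylor_tail z| <= n.+1%:R * 2 ^+ n * M * r.
Proof.
move=> /andP[r0 r1] zr; rewrite /taylor_tail big_mkcond.
apply: le_trans (ler_norm_sum _ _ _) _; rewrite -!mulrA mulr_natl.
rewrite -[in leRHS](card_ord n.+1) -sumr_const; apply: ler_sum => -[i iN] _ /=.
case: ifPn => [i0|_]; last by rewrite normr0 !mulr_ge0 ?exprn_ge0.
apply: le_trans (norm_inv_factZ _ _) _; apply: le_trans (seq_bound_nseq _ _) _ => //.
rewrite mulrCA ler_wpM2l //; apply: (@le_trans _ _ ((2 * r) ^+ i)).
  by rewrite lerXn2r ?nnegrE // mulr_ge0.
rewrite exprMn ler_pM ?exprn_ge0 //; first by rewrite ler_weXn2l // ler1n.
by rewrite -[leRHS]expr1 ler_wiXn2l.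
Qed.

Hypothesis JP : forall k, (k <= n)%N -> sym_multilinear k J.

(** Telescoping: the copies of [a] are replaced by [b] one at a time and collected in [u], each
    replacement costing one factor |a - b|. *)
Lemma seq_bound_dist D k a b u : 1 <= D -> `|a| <= D -> `|b| <= D ->
  (k + size u <= n)%N -> (forall x, x \in u -> `|x| <= D) ->
  `|J (nseq k a ++ u) - J (nseq k b ++ u)| <= k%:R * M * D ^+ n.-1 * `|a - b|.
Proof.
move=> D1 aD bD; elim: k u => [|k IH] u kn uD; first by rewrite subrr normr0 !mul0r.
have sz c : (size (nseq k c ++ u)).+1 = (k + size u).+1.
  by rewrite size_cat size_nseq.
have -> : J (nseq k.+1 a ++ u) - J (nseq k.+1 b ++ u)
    = J (a - b :: nseq k a ++ u) + (J (nseq k a ++ b :: u) - J (nseq k b ++ b :: u)).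
  rewrite (sym_multilinearB _ _ (JP kn)) ?sz //.
  by rewrite !(sym_multilinear_rot _ (JP kn)) ?size_nseq // addrA subrK.
apply: le_trans (ler_normD _ _) _; rewrite -natr1 !mulrDl addrC lerD //.
  rewrite IH //=; first by rewrite addnS.
  by move=> x; rewrite inE => /predU1P[->|/uD].
rewrite mul1r; apply: le_trans (JM _) _; first by rewrite /= sz.
rewrite big_cons mulrCA mulrC ler_wpM2r // ler_wpM2l //.
apply: (@le_trans _ _ (D ^+ size (nseq k a ++ u))); last first.
  by rewrite ler_weXn2l // size_cat size_nseq -ltnS (ltn_predK kn).
have : forall x, x \in nseq k a ++ u -> `|x| <= D.
  move=> x; rewrite mem_cat mem_nseq => /orP[/andP[_ /eqP->//]|/uD//].
elim: (nseq k a ++ u) => [|x s IHs] sD; first by rewrite big_nil.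
rewrite big_cons exprS ler_pM ?prodr_ge0 //; first by rewrite sD ?mem_head.
by apply: IHs => y ys; rewrite sD // inE ys orbT.
Qed.

Lemma taylor_dist D a b : 1 <= D -> `|a| <= D -> `|b| <= D ->
  `|taylor n J a - taylor n J b| <= n.+1%:R * (n%:R * M * D ^+ n.-1 * `|a - b|).
Proof.
move=> D1 aD bD; rewrite /taylor -sumrB; apply: le_trans (ler_norm_sum _ _ _) _.
rewrite mulr_natl -[in leRHS](card_ord n.+1) -sumr_const.
apply: ler_sum => -[k kn] _ /=; rewrite -scalerBr.
apply: le_trans (norm_inv_factZ _ _) _.
have := @seq_bound_dist D k a b [::] D1 aD bD; rewrite addn0 !cats0.
move=> /(_ kn) jD; apply: le_trans (jD _) _ => //.
by rewrite !ler_wpM2r // ?exprn_ge0 ?(le_trans _ D1) // ler_nat.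
Qed.

End SeqBound.

(** * Composition of jets *)

(* The chain rule on the diagonal, where the sum over permutations only
   contributes the factor k!. The terms with j > k, and j = 0 unless k = 0, are
   empty sums. *)
Definition comp_diagonal (R : realType) (E F G : normedModType R) (n : nat)
    (P : seq F -> G) (A : seq E -> F) (H : seq E -> G) : Prop :=
  forall k z, (k <= n)%N -> k`!%:R^-1 *: H (nseq k z) =
    \sum_(j < n.+1) j`!%:R^-1 *:
      \sum_(i : {ffun 'I_j -> 'I_n.+1} |
             [forall l, (0 < i l)%N] && ((\sum_l i l)%N == k))
        P [seq (i l)`!%:R^-1 *: A (nseq (i l) z) | l <- enum 'I_j].

Section Composition.
Variables (R : realType) (E F G : normedModType R) (n : nat).

Section Truncation.
Variables (P : seq F -> G) (A : seq E -> F) (H : seq E -> G) (L M : R).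
Hypothesis L0 : 0 <= L.
Hypotheses (PL : seq_bound n L P) (AM : seq_bound n M A).
Hypothesis PP : forall k, (k <= n)%N -> sym_multilinear k P.
Hypothesis HE : comp_diagonal n P A H.

Let term z j (i : {ffun 'I_j -> 'I_n.+1}) : G :=
  P [seq (i l)`!%:R^-1 *: A (nseq (i l) z) | l <- enum 'I_j].

(** The only difference with [taylor_taylor_tail] is the condition that the orders add up to at most
    [n]: this is the truncation. *)
Lemma taylor_comp z : taylor n H z = \sum_(j < n.+1) j`!%:R^-1 *:
  \sum_(i : {ffun 'I_j -> 'I_n.+1} |
         [forall l, (0 < i l)%N] && (\sum_l i l <= n)%N) term z i.
Proof.
rewrite /taylor (eq_bigr _ (fun (k : 'I_n.+1) _ => HE z (leq_ord k))).
rewrite exchange_big /=; apply: eq_bigr => j _; rewrite -scaler_sumr.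
congr (_ *: _).
rewrite (exchange_big_dep (fun i : {ffun 'I_j -> 'I_n.+1} =>
  [forall l, (0 < i l)%N] && (\sum_l i l <= n)%N)) /=; last first.
  by move=> k i _ /andP[-> /eqP ->]; rewrite leq_ord.
apply: eq_bigr => i /andP[ipos iN]; rewrite (big_pred1 (Ordinal (iN : _ < n.+1)%N)) //.
by move=> k; rewrite ipos /= eq_sym.
Qed.

Lemma taylor_taylor_tail z : taylor n P (taylor_tail n A z)
  = \sum_(j < n.+1) j`!%:R^-1 *:
      \sum_(i : {ffun 'I_j -> 'I_n.+1} | [forall l, (0 < i l)%N]) term z i.
Proof.
apply: eq_bigr => j _; congr (_ *: _).
have := @sym_multilinear_expand _ _ _ P 'I_n.+1 (fun i => (0 < i)%N)
  (fun i => i`!%:R^-1 *: A (nseq i z)) j [::].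
rewrite cats0 addn0 => ->; last by apply: PP; rewrite leq_ord.
by apply: eq_bigr => i _; rewrite cats0.
Qed.

(** [Num.max M 1] allows the number [j] of factors [M] to be raised to [n] uniformly. *)
Lemma comp_term_bound z j (i : {ffun 'I_j -> 'I_n.+1}) : (j <= n)%N ->
  `|term z i| <= L * Num.max M 1 ^+ n * `|z| ^+ (\sum_l i l).
Proof.
move=> jn; have K1 : 1 <= Num.max M 1 by rewrite le_max lexx orbT.
apply: le_trans (PL _) _; first by rewrite size_map size_enum_ord.
rewrite big_map big_enum /= -mulrA ler_wpM2l //.
apply: (@le_trans _ _ (\prod_(l < j) (Num.max M 1 * `|z| ^+ i l))).
  apply: ler_prod => l _; rewrite normr_ge0 /=.
  apply: (le_trans (norm_inv_factZ (i l) (A (nseq (i l) z)))).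
  apply: (le_trans (seq_bound_nseq AM z (leq_ord (i l)))).
  by rewrite ler_wpM2r ?exprn_ge0 // le_max lexx.
rewrite big_split /= prodr_const card_ord prodrXr ler_wpM2r ?exprn_ge0 //.
by rewrite ler_weXn2l.
Qed.

(** The terms are counted crudely by all functions, a number that depends on [n] alone. *)
Lemma comp_diagonal_bound k z : (k <= n)%N ->
  `|k`!%:R^-1 *: H (nseq k z)|
    <= (\sum_(j < n.+1) #|{ffun 'I_j -> 'I_n.+1}|)%:R
         * (L * Num.max M 1 ^+ n * `|z| ^+ k).
Proof.
move=> kn; rewrite HE // natr_sum mulr_suml.
have K0 : 0 <= Num.max M 1 by rewrite le_max ler01 orbT.
apply: le_trans (ler_norm_sum _ _ _) _; apply: ler_sum => -[j jn] _ /=.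
apply: le_trans (norm_inv_factZ _ _) _; apply: le_trans (ler_norm_sum _ _ _) _.
rewrite mulr_natl -sumr_const big_mkcond /=; apply: ler_sum => i _.
case: ifPn => [/andP[_ /eqP <-]|_]; first exact: comp_term_bound.
by rewrite !mulr_ge0 ?exprn_ge0.
Qed.

(** A discarded term has degree between [n.+1] and [n * n] in [z]: the first gives [r ^+ n.+1] as
    [r <= 1], the second bounds the power of the factor 2. *)
Lemma taylor_comp_truncation z r : 0 <= r <= 1 -> `|z| <= 2 * r ->
  `|taylor n P (taylor_tail n A z) - taylor n H z|
    <= (\sum_(j < n.+1) #|{ffun 'I_j -> 'I_n.+1}|)%:R
         * (L * Num.max M 1 ^+ n * 2 ^+ (n * n) * r ^+ n.+1).
Proof.
move=> /andP[r0 r1] zr; set B := (X in _ * X).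
have K0 : 0 <= Num.max M 1 by rewrite le_max ler01 orbT.
have B0 : 0 <= B by rewrite !mulr_ge0 ?exprn_ge0.
rewrite taylor_comp taylor_taylor_tail -sumrB natr_sum mulr_suml.
apply: le_trans (ler_norm_sum _ _ _) _; apply: ler_sum => -[j jn] _ /=.
rewrite -scalerBr; apply: le_trans (norm_inv_factZ _ _) _.
rewrite (bigID (fun i : {ffun 'I_j -> 'I_n.+1} => (\sum_l i l <= n)%N)) /=.
rewrite addrAC subrr add0r; apply: le_trans (ler_norm_sum _ _ _) _.
rewrite mulr_natl -sumr_const big_mkcond /=; apply: ler_sum => i _.
case: ifPn => // /andP[_]; rewrite -ltnNge => iN.
apply: le_trans (comp_term_bound _ _ jn) _.
rewrite /B -!mulrA !ler_wpM2l ?exprn_ge0 //.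
apply: (@le_trans _ _ ((2 * r) ^+ (\sum_l i l))).
  by rewrite lerXn2r ?nnegrE // mulr_ge0.
rewrite exprMn; apply: ler_pM; rewrite ?exprn_ge0 //.
  rewrite ler_weXn2l ?ler1n //; apply: (@leq_trans (\sum_(l < j) n)).
    by apply: leq_sum => l _; rewrite leq_ord.
  by rewrite sum_nat_const card_ord leq_mul2r -ltnS jn orbT.
by rewrite ler_wiXn2l.
Qed.

End Truncation.

End Composition.

(* A, B are the jets of f at x, y, while P, Q are those of g at f x, f y and H, H'
   those of the composition at x, y; h is x - y. *)
Lemma taylor_comp_dist (R : realType) (n : nat) (gamma : R) :
  (0 < n)%N -> n%:R < gamma -> gamma <= n.+1%:R -> exists2 C : R, 0 <= C &
  forall (E F G : normedModType R) (A B : seq E -> F) (P Q : seq F -> G)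
         (H H' : seq E -> G) (M L : R) (h z : E),
    0 <= M -> 0 <= L -> seq_bound n M A -> seq_bound n M B ->
    seq_bound n L P -> seq_bound n L Q ->
    (forall k, (k <= n)%N -> sym_multilinear k B) ->
    (forall k, (k <= n)%N -> sym_multilinear k P) ->
    (forall k, (k <= n)%N -> sym_multilinear k Q) ->
    (forall s, (size s <= n)%N -> `|seq_remainder n A B h s|
       <= M * `|h| `^ (gamma - (size s)%:R) * \prod_(x <- s) `|x|) ->
    (forall s, (size s <= n)%N -> `|seq_remainder n P Q (A [::] - B [::]) s|
       <= L * `|A [::] - B [::]| `^ (gamma - (size s)%:R) * \prod_(x <- s) `|x|) ->
    comp_diagonal n P A H -> comp_diagonal n Q B H' ->
    0 < `|h| <= 1 -> `|z| <= `|h| ->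
    `|taylor n H z - taylor n H' (z + h)|
      <= C * (L * Num.max M 1 `^ gamma * `|h| `^ gamma).
Proof.
move=> n0 ng gn.
have g0 : 0 < gamma by apply: le_lt_trans ng.
have g1 : 1 <= gamma by apply: le_trans (ltW ng); rewrite ler1n.
pose N : R := (\sum_(j < n.+1) #|{ffun 'I_j -> 'I_n.+1}|)%:R.
(* [c1 * M * r] will bound both tails, [(c1 + 1) * M * r] the increment [eta] of f, and [c2] adds
   the two factors. *)
pose c1 : R := n.+1%:R * 2 ^+ n.
have c10 : 0 <= c1 by rewrite mulr_ge0 ?exprn_ge0.
pose c2 : R := 2 * c1 + 1.
have c20 : 1 <= c2 by rewrite lerDr mulr_ge0.
exists (n.+1%:R * c2 `^ gamma + n.+1%:R * (n%:R * c2 ^+ n.-1 * n.+1%:R)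
    + 2 * (N * 2 ^+ (n * n))) => [|E F G A B P Q H H' M L h z M0 L0].
  by rewrite !addr_ge0 ?mulr_ge0 ?powR_ge0 ?exprn_ge0 ?(le_trans _ c20) ?ler0n.
move=> AM BM PL QL BP PP QP remA remP HE HE'; set r := `|h| => /andP[r0 r1] zr.
set K := Num.max M 1; set Kr := K `^ gamma * r `^ gamma.
have K1 : 1 <= K by rewrite le_max lexx orbT.
have MK : M <= K by rewrite le_max lexx.
have KnK : K ^+ n <= K `^ gamma.
  by rewrite -powR_mulrn ?ler_powR ?(ltW ng) // (le_trans _ K1).
have rg : r `^ gamma <= r by rewrite -[leRHS]powRr1 ?ger_powR ?r0 // ltW.
set eta := A [::] - B [::] in remP *.
set p := taylor_tail n A z; set b := taylor_tail n B (z + h).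
pose rho := taylor n A z - taylor n B (z + h).
(* [rho] is the Taylor error of f: the tails [p] and [b] at the two base points differ by [eta] up
   to it. *)
have bE : b = p + eta - rho.
  rewrite /rho !taylor_tailE -/p -/b /eta opprB [p + _]addrCA [A [::] + (p - _)]addrA.
  by rewrite -[B [::] + b - _]addrA subrKA [RHS]addrC subrK.
have z2r : `|z| <= 2 * r by rewrite (le_trans zr) // ler_peMl ?(ltW r0) // ler1n.
have zh2r : `|z + h| <= 2 * r.
  by rewrite (le_trans (ler_normD _ _)) // mulr_natl mulr2n lerD.
have r01 : 0 <= r <= 1 by rewrite ltW.
have rhoB : `|rho| <= n.+1%:R * M * r `^ gamma.
  rewrite /rho taylor_seq_remainder //; apply: le_trans (ler_norm_sum _ _ _) _.
  rewrite -mulrA mulr_natl -[in leRHS](card_ord n.+1) -sumr_const.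
  apply: ler_sum => -[k kn] _ /=; apply: le_trans (norm_inv_factZ _ _) _.
  apply: le_trans (remA _ _) _; rewrite size_nseq //.
  rewrite big_nseq iter_mulr_1 -mulrA ler_wpM2l //.
  apply: powR_split; rewrite ?lexx ?normr_ge0 ?(ltW r0) ?zr //.
  by apply: le_lt_trans ng; rewrite ler_nat.
(* The order 0 remainder formula of f between the two points; r^gamma <= r because gamma >= 1. *)
have etaB : `|eta| <= (c1 + 1) * M * r.
  have -> : eta = taylor_tail n B h + seq_remainder n A B h [::].
    by rewrite /seq_remainder subn0 -/(taylor n B h) taylor_tailE [RHS]addrC opprD addrA subrK.
  apply: le_trans (ler_normD _ _) _; rewrite -mulrA mulrDl mul1r lerD //.
    by rewrite mulrA taylor_tail_bound // -/r ler_peMl ?(ltW r0) // ler1n.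
  apply: le_trans (remA _ _) _ => //; rewrite big_nil mulr1 subr0 -/r.
  by rewrite ler_wpM2l.
have pB : `|p| <= c1 * M * r by rewrite taylor_tail_bound.
have bB : `|b| <= c1 * M * r by rewrite taylor_tail_bound.
pose a := c2 * M * r; have a0 : 0 <= a by rewrite !mulr_ge0 ?(ltW r0) // (le_trans _ c20).
have aE : a = c1 * M * r + (c1 + 1) * M * r by rewrite /a /c2; ring.
have Mr0 : 0 <= M * r by rewrite mulr_ge0 ?(ltW r0).
have c1a : c1 * M * r <= a by rewrite aE lerDl -mulrA mulr_ge0 // addr_ge0.
have etaa : (c1 + 1) * M * r <= a by rewrite aE lerDr -mulrA mulr_ge0.
pose D := c2 * K; have D1 : 1 <= D by rewrite mulr_ege1.
have aD : a <= D.
  by rewrite /a /D -mulrA ler_wpM2l ?(le_trans _ c20) // (le_trans _ MK) // ler_piMr.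
(* Remainder of g: [p] and [eta] have norm at most [a], of order M r, so all orders give a^gamma,
   whence M^gamma. *)
have X1 : `|taylor n P p - taylor n Q (p + eta)| <= n.+1%:R * c2 `^ gamma * (L * Kr).
  rewrite taylor_seq_remainder //; apply: le_trans (ler_norm_sum _ _ _) _.
  rewrite -mulrA mulr_natl -[in leRHS](card_ord n.+1) -sumr_const.
  apply: ler_sum => -[k kn] _ /=; apply: le_trans (norm_inv_factZ _ _) _.
  apply: le_trans (remP _ _) _; rewrite size_nseq //.
  rewrite big_nseq iter_mulr_1 -mulrA [leRHS]mulrCA ler_wpM2l //.
  apply: (@le_trans _ _ (a `^ gamma)).
    apply: powR_split; rewrite ?normr_ge0 ?(le_trans pB) ?(le_trans etaB) //.
    by apply: le_lt_trans ng; rewrite ler_nat.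
  rewrite /a !powRM ?mulr_ge0 ?(ltW r0) ?(le_trans _ c20) // /Kr mulrA.
  rewrite ler_wpM2r ?powR_ge0 // ler_wpM2l ?powR_ge0 //.
  by rewrite ge0_ler_powR ?nnegrE ?(ltW g0) // (le_trans _ K1).
(* Error of f: both arguments lie in the ball of radius [D], where the Taylor polynomial of g is
   Lipschitz. [K ^+ n.-1] times the [M] from [rho] is at most [K ^+ n], as n > 0. *)
have X2 : `|taylor n Q (p + eta) - taylor n Q b|
    <= n.+1%:R * (n%:R * c2 ^+ n.-1 * n.+1%:R) * (L * Kr).
  apply: le_trans (taylor_dist L0 QL QP D1 _ _) _.
  - by rewrite (le_trans _ aD) // aE (le_trans (ler_normD _ _)) // lerD.
  - by rewrite (le_trans bB) // (le_trans c1a).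
  rewrite -[leRHS]mulrA ler_wpM2l // bE opprB addrCA subrr addr0.
  apply: le_trans (ler_wpM2l _ rhoB) _.
    by rewrite !mulr_ge0 ?exprn_ge0 // (le_trans _ D1).
  rewrite /D exprMn.
  have -> : n%:R * L * (c2 ^+ n.-1 * K ^+ n.-1) * (n.+1%:R * M * r `^ gamma)
    = n%:R * c2 ^+ n.-1 * n.+1%:R * (L * ((K ^+ n.-1 * M) * r `^ gamma)) by ring.
  rewrite ler_wpM2l ?mulr_ge0 ?exprn_ge0 ?(le_trans _ c20) // ler_wpM2l // ler_wpM2r ?powR_ge0 //.
  rewrite (le_trans _ KnK) // -[in leRHS](prednK n0) exprSr ler_wpM2l //.
  by rewrite exprn_ge0 // (le_trans _ K1).
(* [r ^+ n.+1] is at most r^gamma because r <= 1 and gamma <= n + 1. *)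
have X3 T : T <= N * (L * K ^+ n * 2 ^+ (n * n) * r ^+ n.+1) ->
    T <= N * 2 ^+ (n * n) * (L * Kr).
  move=> /le_trans; apply.
  have -> : N * (L * K ^+ n * 2 ^+ (n * n) * r ^+ n.+1)
     = N * 2 ^+ (n * n) * (L * (K ^+ n * r ^+ n.+1)) by ring.
  rewrite ler_wpM2l ?mulr_ge0 ?exprn_ge0 ?ler0n // ler_wpM2l //.
  rewrite ler_pM ?exprn_ge0 ?(ltW r0) ?(le_trans _ K1) //.
  by rewrite -powR_mulrn ?(ltW r0) // ger_powR ?r0.
have X4 := X3 _ (taylor_comp_truncation L0 PL AM PP HE r01 z2r).
have X5 := X3 _ (taylor_comp_truncation L0 QL BM QP HE' r01 zh2r).
(* The base point of g moves from f x to f y, then the argument from [p + eta] to [b]; the two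
   truncation errors remain. *)
have -> : taylor n H z - taylor n H' (z + h)
  = (taylor n P p - taylor n Q (p + eta)) + (taylor n Q (p + eta) - taylor n Q b)
    + ((taylor n Q b - taylor n H' (z + h)) - (taylor n P p - taylor n H z)).
  by rewrite subrKA opprB addrA subrKA addrC subrKA.
rewrite -[L * _ * _]mulrA -/Kr mulrDl [X in _ <= X + _]mulrDl.
rewrite (le_trans (ler_normD _ _)) // lerD //.
  by rewrite (le_trans (ler_normD _ _)) // lerD.
rewrite (le_trans (ler_normB _ _)) // -mulrA mulr_natl mulr2n.
by rewrite lerD.
Qed.

(** * From diagonals to arbitrary arguments *)

Lemma seq_remainder_sym_multilinear (R : numFieldType) (E F : lmodType R) n
    (J J' : seq E -> F) h k :
  (forall k, (k <= n)%N -> sym_multilinear k J) ->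
  (forall k, (k <= n)%N -> sym_multilinear k J') ->
  (k <= n)%N -> sym_multilinear k (seq_remainder n J J' h).
Proof.
move=> JP JP' kn; have km (m : 'I_(n - k).+1) : (k + m <= n)%N.
  by rewrite -leq_subRL // leq_ord.
split=> [s t sk st|s sk a x y].
  rewrite /seq_remainder (sym_multilinear_perm (JP k kn) sk st).
  rewrite -(perm_size st) sk; congr (_ - _); apply: eq_bigr => m _.
  congr (_ *: _); apply: (sym_multilinear_perm (JP' _ (km m))).
    by rewrite size_cat size_nseq sk.
  by rewrite perm_cat2r.
rewrite /seq_remainder /= !sk.
rewrite (sym_multilinearD _ _ (JP k kn)) // (sym_multilinearZ _ _ (JP k kn)) //.
rewrite scalerBr addrACA; congr (_ + _); rewrite -opprD scaler_sumr -big_split /=.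
congr (- _); apply: eq_bigr => m _.
have sm : (size (s ++ nseq m h)).+1 = (k + m)%N.
  by rewrite size_cat size_nseq -addSn sk.
rewrite (sym_multilinearD _ _ (JP' _ (km m))) // (sym_multilinearZ _ _ (JP' _ (km m))) //.
by rewrite scalerDr !scalerA mulrC.
Qed.

Lemma polarization_bound_le (R : realType) n : exists2 C : R, 0 <= C &
  forall (E F : normedModType R) (J : seq E -> F) (K : R) k, (k <= n)%N ->
    sym_multilinear k J -> 0 <= K -> (forall z, `|J (nseq k z)| <= K * `|z| ^+ k) ->
    forall s, size s = k -> `|J s| <= C * K * \prod_(x <- s) `|x|.
Proof.
elim: n => [|n [C C0 IH]].
  have [C C0 CP] := polarization_bound R 0; exists C => // E F J K k.
  by rewrite leqn0 => /eqP ->; exact: CP.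
have [D D0 DP] := polarization_bound R n.+1; exists (C + D); first exact: addr_ge0.
move=> E F J K k; rewrite leq_eqVlt => /predU1P[->|kn] JP K0 JK s sk.
  apply: le_trans (DP _ _ _ _ JP K0 JK s sk) _.
  by rewrite !ler_wpM2r ?prodr_ge0 // lerDr.
apply: le_trans (IH _ _ _ _ _ kn JP K0 JK s sk) _.
by rewrite !ler_wpM2r ?prodr_ge0 // lerDl.
Qed.

(** The hypothesis [h = 0 -> H = H'] records that equal points carry equal jets: the required bound
    on the remainder is then 0, and no rescaling by |h| is possible. *)
Lemma seq_lip_comp (R : realType) (n : nat) (gamma : R) :
  (0 < n)%N -> n%:R < gamma -> gamma <= n.+1%:R -> exists2 C : R, 0 <= C &
  forall (E F G : normedModType R) (A B : seq E -> F) (P Q : seq F -> G)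
         (H H' : seq E -> G) (M L : R) (h : E),
    0 <= M -> 0 <= L -> seq_bound n M A -> seq_bound n M B ->
    seq_bound n L P -> seq_bound n L Q ->
    (forall k, (k <= n)%N -> sym_multilinear k B) ->
    (forall k, (k <= n)%N -> sym_multilinear k P) ->
    (forall k, (k <= n)%N -> sym_multilinear k Q) ->
    (forall k, (k <= n)%N -> sym_multilinear k H) ->
    (forall k, (k <= n)%N -> sym_multilinear k H') ->
    (forall s, (size s <= n)%N -> `|seq_remainder n A B h s|
       <= M * `|h| `^ (gamma - (size s)%:R) * \prod_(x <- s) `|x|) ->
    (forall s, (size s <= n)%N -> `|seq_remainder n P Q (A [::] - B [::]) s|
       <= L * `|A [::] - B [::]| `^ (gamma - (size s)%:R) * \prod_(x <- s) `|x|) ->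
    comp_diagonal n P A H -> comp_diagonal n Q B H' -> (h = 0 -> H = H') ->
    forall s, (size s <= n)%N ->
      `|H s| <= C * (L * Num.max M 1 `^ gamma) * \prod_(x <- s) `|x| /\
      `|seq_remainder n H H' h s| <= C * (L * Num.max M 1 `^ gamma)
          * `|h| `^ (gamma - (size s)%:R) * \prod_(x <- s) `|x|.
Proof.
move=> n0 ng gn.
have [Cp Cp0 CpP] := polarization_bound_le R n.
have [Cc Cc0 CcP] := bounded_coef R n.
have [Cd Cd0 CdP] := taylor_comp_dist n0 ng gn.
pose N : R := (\sum_(j < n.+1) #|{ffun 'I_j -> 'I_n.+1}|)%:R.
(* [Cb] bounds the composed jet, [Cr] its remainder for |h| <= 1. The factor [n.+2] below counts the
   terms of a remainder when |h| > 1. *)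
pose Cb := Cp * (n`!%:R * N); pose Cr := Cp * (n`!%:R * (Cc * Cd)).
have N0 : 0 <= N by rewrite ler0n.
have Cb0 : 0 <= Cb by rewrite !mulr_ge0.
have Cr0 : 0 <= Cr by rewrite !mulr_ge0.
exists (Cb * n.+2%:R + Cr) => [|E F G A B P Q H H' M L h M0 L0].
  by rewrite addr_ge0 // mulr_ge0.
move=> AM BM PL QL BP PP QP HP HP' remA remP HE HE' hH.
set LK := L * _; have LK0 : 0 <= LK by rewrite mulr_ge0 ?powR_ge0.
have K1 : 1 <= Num.max M 1 by rewrite le_max lexx orbT.
have fact_mono k (v : G) c : (k <= n)%N -> `|k`!%:R^-1 *: v| <= c -> `|v| <= n`!%:R * c.
  move=> kn; rewrite normrZ ger0_norm ?invr_ge0 // ler_pdivrMl ?ltr0n ?fact_gt0 //.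
  move=> vc; have c0 : 0 <= c.
    have := le_trans (normr_ge0 v) vc; rewrite pmulr_rge0 // ltr0n fact_gt0 //.
  by apply: le_trans vc _; rewrite ler_wpM2r // ler_nat leq_fact.
have bound (P' : seq F -> G) (A' : seq E -> F) (H1 : seq E -> G) : seq_bound n L P' -> seq_bound n M A' -> comp_diagonal n P' A' H1 ->
    (forall k, (k <= n)%N -> sym_multilinear k H1) -> seq_bound n (Cb * LK) H1.
  move=> PL' AM' HE1 HP1 s sn.
  have -> : Cb * LK = Cp * (n`!%:R * (N * LK)) by rewrite /Cb; ring.
  apply: (CpP _ _ _ _ (size s)) => //; [exact: HP1|by rewrite mulr_ge0 ?ler0n // mulr_ge0|].
  move=> z; rewrite -!mulrA; apply: (fact_mono _ _ _ sn).
  apply: le_trans (comp_diagonal_bound L0 PL' AM' HE1 z sn) _.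
  rewrite ler_wpM2l // mulrA ler_wpM2r ?exprn_ge0 // ler_wpM2l //.
  by rewrite -powR_mulrn ?ler_powR ?(ltW ng) // (le_trans _ K1).
have HB := bound _ _ _ PL AM HE HP; have HB' := bound _ _ _ QL BM HE' HP'.
move=> s sn; set k := size s; set p := \prod_(x <- s) _.
have p0 : 0 <= p by rewrite prodr_ge0.
have kg : 0 < gamma - k%:R by rewrite subr_gt0 (le_lt_trans _ ng) // ler_nat.
split.
  apply: le_trans (HB _ sn) _; rewrite !ler_wpM2r //.
  by rewrite -[leLHS]mulr1 (le_trans _ (_ : Cb * n.+2%:R <= _)) ?lerDl // ler_wpM2l // ler1n.
(* The term m = 0 cancels and every other one has the zero vector among its arguments. *)
have [h0|h0] := eqVneq h 0.
  rewrite h0 normr0 powR0 ?gt_eqF // mulr0 mul0r -hH // /seq_remainder.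
  rewrite big_ord_recl fact0 invr1 scale1r cats0.
  rewrite big1 ?addr0 ?subrr ?normr0 // => m _.
  have km : (size s + m.+1 <= n)%N by rewrite -leq_subRL //.
  rewrite /= (sym_multilinear_rot _ (HP _ km)) ?size_nseq ?addnS //.
  by rewrite (sym_multilinear0 (HP _ km)) ?size_cat ?size_nseq ?scaler0 ?addnS.
have r0 : 0 < `|h| by rewrite normr_gt0.
(* If |h| > 1, each |h|^m with m <= n - k is at most |h|^(gamma - k), because n < gamma. *)
have [r1|r1] := leP `|h| 1; last first.
  have kr1 m : (m <= n - k)%N -> `|h| ^+ m <= `|h| `^ (gamma - k%:R).
    move=> mn; rewrite -powR_mulrn // ler_powR ?(ltW r1) // lerBrDr -natrD.
    by apply: le_trans (ltW ng); rewrite ler_nat addnC -leq_subRL.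
  have HBk : `|H s| <= Cb * LK * p * `|h| `^ (gamma - k%:R).
    apply: le_trans (HB _ sn) _; rewrite ler_peMr //; first by rewrite mulr_ge0 // mulr_ge0.
    by apply: le_trans (kr1 0%N _); rewrite ?expr0.
  apply: (@le_trans _ _ (n.+2%:R * (Cb * LK * p * `|h| `^ (gamma - k%:R)))).
    rewrite -nat1r mulrDl mul1r; apply: le_trans (ler_normB _ _) _; apply: lerD => //.
    apply: le_trans (ler_norm_sum _ _ _) _.
    apply: (@le_trans _ _ (\sum_(m < (n - k).+1) (Cb * LK * p * `|h| `^ (gamma - k%:R)))).
      apply: ler_sum => m _; apply: le_trans (norm_inv_factZ _ _) _.
      apply: le_trans (HB' _ _) _.
        by rewrite size_cat size_nseq -leq_subRL ?leq_ord.
      rewrite big_cat big_nseq iter_mulr_1 mulrA.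
      apply: ler_wpM2l; last exact: kr1 (leq_ord m).
      by rewrite mulr_ge0 // mulr_ge0.
    rewrite sumr_const card_ord -[leLHS]mulr_natl; apply: ler_wpM2r.
      by rewrite mulr_ge0 ?powR_ge0 // mulr_ge0 // mulr_ge0.
    by rewrite ler_nat ltnS leq_subr.
  have -> : n.+2%:R * (Cb * LK * p * `|h| `^ (gamma - k%:R))
    = Cb * n.+2%:R * LK * `|h| `^ (gamma - k%:R) * p by ring.
  by rewrite !ler_wpM2r ?powR_ge0 // lerDl.
have hE : `|h| `^ gamma / `|h| ^+ k = `|h| `^ (gamma - k%:R).
  by rewrite powRB ?powR_mulrn // (gt_eqF r0) implybT.
apply: (@le_trans _ _ (Cr * LK * `|h| `^ (gamma - k%:R) * p)); last first.
  by rewrite !ler_wpM2r ?powR_ge0 // lerDr mulr_ge0.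
have SP := seq_remainder_sym_multilinear h HP HP' sn.
rewrite -hE; have -> : Cr * LK * (`|h| `^ gamma / `|h| ^+ k)
  = Cp * (n`!%:R * (Cc * (Cd * (LK * `|h| `^ gamma))) / `|h| ^+ k) by rewrite /Cr; ring.
apply: (CpP _ _ _ _ k) => //.
  by rewrite divr_ge0 ?mulr_ge0 ?powR_ge0 ?exprn_ge0.
apply: sym_multilinear_homogeneous => // z zr; apply: (fact_mono _ _ _ sn).
(* For fixed [z] the estimate at [t *: z] bounds a polynomial in t on [0, 1] whose coefficients are
   the remainders divided by factorials. *)
apply: (CcP _ (fun m => m`!%:R^-1 *: seq_remainder n H H' h (nseq m z))) => // t /andP[t0 t1].
have -> : \sum_(m < n.+1) t ^+ m *: (m`!%:R^-1 *: seq_remainder n H H' h (nseq m z))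
    = taylor n H (t *: z) - taylor n H' (t *: z + h).
  rewrite taylor_seq_remainder //; apply: eq_bigr => -[m mn] _ /=.
  have Sm := seq_remainder_sym_multilinear h HP HP' mn.
  have := sym_multilinear_nseqZ t z (m := m) (u := [::]) Sm.
  by rewrite !cats0 addn0 => -> //; rewrite !scalerA mulrC.
rewrite /LK (CdP _ _ _ A B P Q) ?r0 //.
by rewrite normrZ ger0_norm // (le_trans _ zr) // ler_piMl.
Qed.

(** * From tensor powers to sequences *)

Section LinearMaps.
Variables (R : fieldType).

Lemma linear_sumr (V W : lmodType R) (I : Type) (r : seq I) (P : pred I)
    (f : I -> V -> W) :
  (forall i, P i -> linear (f i)) -> linear (fun v => \sum_(i <- r | P i) f i v).
Proof.
move=> fP a u v; rewrite scaler_sumr -big_split /=.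
by apply: eq_bigr => i Pi; rewrite fP.
Qed.

Lemma linear_scaler (V W : lmodType R) (c : R) (f : V -> W) :
  linear f -> linear (fun v => c *: f v).
Proof. by move=> fP a u v; rewrite fP scalerDr !scalerA mulrC. Qed.

Lemma linear_fun_comp (U V W : lmodType R) (g : V -> W) (f : U -> V) :
  linear g -> linear f -> linear (fun v => g (f v)).
Proof. by move=> gP fP a u v; rewrite fP gP. Qed.

Lemma linear_fun0 (V W : lmodType R) (f : V -> W) : linear f -> f 0 = 0.
Proof.
by move=> fP; have := fP (-1) 0 0; rewrite scaler0 addr0 scaleN1r addNr.
Qed.

Lemma linear_funZ (V W : lmodType R) (f : V -> W) a v :
  linear f -> f (a *: v) = a *: f v.
Proof. by move=> fP; have := fP a v 0; rewrite !addr0 (linear_fun0 fP) addr0. Qed.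

Lemma linear_fun_sum (V W : lmodType R) (f : V -> W) (I : Type) (r : seq I)
    (P : pred I) (v : I -> V) : linear f ->
  f (\sum_(i <- r | P i) v i) = \sum_(i <- r | P i) f (v i).
Proof.
move=> fP; apply: (big_morph f _ (linear_fun0 fP)) => u w.
by have := fP 1 u w; rewrite !scale1r.
Qed.

End LinearMaps.

Section TensorMaps.
Variables (R : fieldType) (E F : lmodType R).

Lemma tpermute_linear k (s : 'S_k) : linear (@tpermute R E k s).
Proof.
apply: tlift_linear => v i a x y.
have setE z : [tuple tnth (tset v i z) (s m) | m < k]
    = tset [tuple tnth v (s m) | m < k] (s^-1 i)%g z.
  by apply: eq_from_tnth => m; rewrite !tnth_mktuple (canF_eq (permK s)).
by rewrite !setE pure_multilinear.
Qed.

Section Offset.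
Variables (j : nat) (d : 'I_j -> nat).

Lemma offsetS (l : 'I_j) : offset d l.+1 = (offset d l + d l)%N.
Proof.
rewrite /offset (bigD1 l) //= addnC; congr (_ + _)%N; apply: eq_bigl => m.
by rewrite ltnS ltn_neqAle andbC.
Qed.

Lemma offset_sum : offset d j = (\sum_l d l)%N.
Proof. by apply: eq_bigl => l; rewrite ltn_ord. Qed.

Lemma leq_offset m n : (m <= n)%N -> (offset d m <= offset d n)%N.
Proof.
move=> mn; rewrite /offset [leqLHS]big_mkcond [leqRHS]big_mkcond /=.
apply: leq_sum => l _; case: ifP => // lm.
by rewrite (leq_trans lm mn).
Qed.

Lemma offset_block i : (i < \sum_l d l)%N ->
  exists l : 'I_j, (offset d l <= i < offset d l + d l)%N.
Proof.
rewrite -offset_sum => ij.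
have [l lP lmin] := ex_minnP (ex_intro (fun l => i < offset d l)%N j ij).
case: l lP lmin => [|l] lP lmin; first by rewrite /offset big_pred0 in lP.
exists (Ordinal (lmin j ij)); rewrite -offsetS lP andbT leqNgt.
by apply/negP => /lmin; rewrite ltnn.
Qed.

End Offset.

(** Changing entry [i] changes one entry of the one block that contains it, and the factor of [h] on
    that block is linear. *)
Lemma tprod_linear k j (d : 'I_j -> nat) (h : forall l : 'I_j, tpow E (d l) -> F) :
  (\sum_l d l)%N = k -> (forall l, linear (h l)) -> linear (@tprod R E F k j d h).
Proof.
move=> dk hP; apply: tlift_linear => v i a x y.
have [l0 /andP[l0i il0]] : exists l : 'I_j, (offset d l <= i < offset d l + d l)%N.
  by apply: offset_block; rewrite dk.
have i0P : (i - offset d l0 < d l0)%N by rewrite ltn_subLR.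
have blockP (l : 'I_j) (m : 'I_(d l)) : (offset d l + m)%N = i -> l = l0.
  move=> mi; apply: val_inj; have [ll|ll|//] := ltngtP l l0; exfalso.
    have := leq_trans (leq_offset d ll) l0i.
    by rewrite offsetS -mi leqNgt ltn_add2l ltn_ord.
  have := leq_trans il0 (leq_trans (eq_leq (esym (offsetS d l0))) (leq_offset d ll)).
  by rewrite -mi ltnNge leq_addr.
have block0E z : block d (tset v i z) l0 = tset (block d v l0) (Ordinal i0P) z.
  apply: eq_from_tnth => m; rewrite !tnth_mktuple nth_tset -val_eqE /=.
  by rewrite -[in RHS](eqn_add2l (offset d l0)) subnKC.
have blockE z (l : 'I_j) : l <> l0 -> block d (tset v i z) l = block d v l.
  move=> ll0; apply: eq_from_tnth => m; rewrite !tnth_mktuple nth_tset.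
  by case: eqP => // /blockP.
have setE z : [tuple h l (pure (block d (tset v i z) l)) | l < j]
    = tset [tuple h l (pure (block d v l)) | l < j] l0
        (h l0 (pure (tset (block d v l0) (Ordinal i0P) z))).
  apply: eq_from_tnth => l; rewrite !tnth_mktuple.
  by case: eqP => [->|ll0]; [rewrite block0E|rewrite blockE].
by rewrite !setE pure_multilinear hP pure_multilinear.
Qed.

Lemma tpermute0 (s : 'S_0) (v : tpow E 0) : tpermute s v = v.
Proof.
apply: (pure_span (tpermute_linear s) (q := id)) => // t.
by rewrite tpermute_pure [in LHS]tuple0 [in RHS]tuple0.
Qed.

Lemma tpermuteM k (s t : 'S_k) (v : tpow E k) :
  tpermute s (tpermute t v) = tpermute (s * t)%g v.
Proof.
move: v; apply: pure_span => [||v]; last rewrite !tpermute_pure.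
- exact: linear_fun_comp (tpermute_linear s) (tpermute_linear t).
- exact: tpermute_linear.
by congr pure; apply: eq_from_tnth => i; rewrite !tnth_mktuple permM.
Qed.

End TensorMaps.

(** Symmetry comes from the sum over all permutations, which right multiplication by [s] merely
    reindexes. *)
Lemma jet_comp_sym (R : realType) (E F G : normedModType R) (n : nat)
    (g : jet F G) (f : jet E F) x k :
  (forall j, (j <= n)%N -> linear (g j (jet0 f x))) ->
  (forall j, (j <= n)%N -> linear (f j x)) ->
  (k <= n)%N -> symmetric_linear (jet_comp n g f (k := k) x).
Proof.
move=> gP fP; case: k => [|k] kn.
  split=> [|s v]; first by apply: tlift_linear => v [].
  by rewrite tpermute0.
split=> [|s v]; last first.
  rewrite /jet_comp; apply: eq_bigr => j _; congr (_ *: g j _ _).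
  apply: eq_bigr => i _; congr (_ *: tprod _ _).
  rewrite [RHS](reindex_inj (mulIg s)) /=.
  by apply: eq_bigr => t _; rewrite tpermuteM.
rewrite /jet_comp => a u v; rewrite !big_nat.
pose body j v := j`!%:R^-1 *: g j (jet0 f x)
  (\sum_(i : {ffun 'I_j -> 'I_n.+1} |
         [forall l, (0 < i l)%N] && ((\sum_l i l)%N == k.+1))
     (\prod_l (i l)`!%:R)^-1 *: tprod (d := fun l => i l) (fun l => f (i l) x)
       (\sum_(s : 'S_k.+1) tpermute s v)).
apply: (@linear_sumr _ _ _ _ _ _ body) => j /andP[_ jk].
apply/linear_scaler/linear_fun_comp; first by apply: gP; rewrite (leq_trans _ kn).
apply: linear_sumr => i /andP[_ /eqP ik]; apply/linear_scaler/linear_fun_comp.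
  by apply: tprod_linear => // l; apply: fP; rewrite leq_ord.
by apply: linear_sumr => s _; exact: tpermute_linear.
Qed.

Definition seq_jet (R : realType) (E F : normedModType R) (f : jet E F) (x : E)
    (s : seq E) : F :=
  f (size s) x (pure (in_tuple s)).

Section SeqJet.
Variables (R : realType) (E F : normedModType R).

Lemma seq_jetE (f : jet E F) k x (v : k.-tuple E) : seq_jet f x v = f k x (pure v).
Proof.
case: v => s sk; have kE := eqP sk.
by subst k; congr (f _ _ (pure _)); apply: val_inj.
Qed.

Lemma seq_jet0 (f : jet E F) x : seq_jet f x [::] = jet0 f x.
Proof. by rewrite -[LHS]/(seq_jet f x [tuple]) seq_jetE. Qed.

Lemma seq_jet_sym_multilinear (f : jet E F) k x :
  symmetric_linear (f k x) -> sym_multilinear k (seq_jet f x).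
Proof.
move=> [fP fS]; split=> [s t sk st|s sk a y z].
  have tk : size t = k by rewrite -(perm_size st) sk.
  subst k; have sE : s = in_tuple s :> seq E by [].
  have tT : size t == size s by rewrite tk.
  have /tuple_permP[p sp] : perm_eq s (Tuple tT) by [].
  rewrite -[t]/(val (Tuple tT)) seq_jetE -[RHS](fS p) tpermute_pure.
  by congr (f _ _ (pure _)); apply: val_inj; rewrite /= -sp.
subst k; have consE w : w :: s = tset (in_tuple (0 :: s)) ord0 w :> seq E.
  apply: (@eq_from_nth _ 0); rewrite ?size_tuple // => i _.
  by rewrite nth_tset; case: i.
by rewrite !consE !seq_jetE pure_multilinear fP.
Qed.

Lemma remainder_seq (f : jet E F) n x y k (v : k.-tuple E) :
  (forall j, (j <= n)%N -> linear (f j y)) -> (k <= n)%N ->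
  remainder n f x y (pure v) = seq_remainder n (seq_jet f x) (seq_jet f y) (x - y) v.
Proof.
move=> fP kn; rewrite /remainder /seq_remainder size_tuple seq_jetE big_mkord.
congr (_ - _); apply: eq_bigr => m _.
rewrite linear_funZ; last by apply: fP; rewrite -leq_subRL // leq_ord.
by rewrite /texp tmul_pure -seq_jetE.
Qed.

End SeqJet.

Section TensorNorms.
Variables (R : realType) (E : normedModType R) (N : tensor_norms E).

Lemma tnorm_ge0 k (t : tpow E k) : 0 <= N k t.
Proof.
have N0 : N k 0 = 0 by rewrite -(scale0r (0 : tpow E k)) tnormZ normr0 mul0r.
have := tnorm_triangle N t (- t); rewrite subrr N0 -scaleN1r tnormZ normrN1 mul1r.
by rewrite -mulr2n pmulrn_lge0.
Qed.

Lemma tnorm_pure_seq k (v : k.-tuple E) : N k (pure v) = N (size v) (pure (in_tuple v)).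
Proof.
case: v => s sk; have kE := eqP sk; subst k.
by congr (N _ (pure _)); apply: val_inj.
Qed.

(** Induction from the right end, where [cross_norm] splits off a vector; [tnorm_scalar] starts
    it. *)
Lemma cross_norm_pure k (v : k.-tuple E) : cross_norm N ->
  N k (pure v) = \prod_(x <- v) `|x|.
Proof.
move=> crossN; rewrite tnorm_pure_seq; elim/last_ind: (tval v) => [|s x IH].
  rewrite big_nil -[RHS](tnorm_scalar N).
  by congr (N _ (pure _)); apply: val_inj.
rewrite -cats1 big_cat big_seq1 -IH /= -crossN tmul_pure.
by rewrite [RHS]tnorm_pure_seq.
Qed.

(** One-element lists are a base case as well: [projective] concerns positive orders only. *)
Lemma projective_pure k (v : k.-tuple E) : projective N ->
  N k (pure v) <= \prod_(x <- v) `|x|.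
Proof.
move=> projN; rewrite tnorm_pure_seq; elim: (tval v) => [|x [|y s] IH].
- rewrite big_nil -(tnorm_scalar N).
  by rewrite (_ : in_tuple [::] = [tuple of [::]]) //; apply: val_inj.
- rewrite big_seq1 -(tnorm_vector N).
  by rewrite (_ : in_tuple [:: x] = [tuple x]) //; apply: val_inj.
rewrite big_cons -(tnorm_vector N); apply: le_trans (ler_wpM2l (tnorm_ge0 _) IH).
apply: le_trans (projN _ _ _ _ _ _) => //.
by rewrite tmul_pure [leRHS]tnorm_pure_seq.
Qed.

End TensorNorms.

Section CompDiagonal.
Variables (R : realType) (E F G : normedModType R) (n : nat).

Lemma block_nseq k j (d : 'I_j -> nat) (z : E) l : (\sum_l d l)%N = k ->
  block d [tuple of nseq k z] l = [tuple of nseq (d l) z].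
Proof.
move=> dk; apply: eq_from_tnth => m; rewrite tnth_mktuple !(tnth_nth 0) /=.
rewrite !nth_nseq ltn_ord ifT // -dk -offset_sum.
apply: leq_trans (leq_offset d (ltn_ord l)).
by rewrite offsetS ltn_add2l.
Qed.

Lemma sum_tpermute_nseq k (z : E) :
  \sum_(s : 'S_k) tpermute s (pure [tuple of nseq k z])
    = k`!%:R *: pure [tuple of nseq k z].
Proof.
rewrite (eq_bigr (fun=> pure [tuple of nseq k z])) => [|s _]; last first.
  rewrite tpermute_pure; congr pure; apply: eq_from_tnth => i.
  by rewrite tnth_mktuple !(tnth_nth 0) /= !nth_nseq !ltn_ord.
by rewrite sumr_const card_Sn scaler_nat.
Qed.

(** Multilinearity of g^j distributes the product of inverse factorials over its arguments. *)
Lemma tprod_nseq (g : jet F G) (f : jet E F) x k j (i : {ffun 'I_j -> 'I_n.+1}) z :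
  symmetric_linear (g j (jet0 f x)) ->
  (forall m, (m <= n)%N -> linear (f m x)) -> (\sum_l i l)%N = k ->
  g j (jet0 f x) ((\prod_l (i l)`!%:R)^-1 *:
      tprod (d := fun l => i l) (fun l => f (i l) x) (pure [tuple of nseq k z]))
    = seq_jet g (jet0 f x)
        [seq (i l)`!%:R^-1 *: seq_jet f x (nseq (i l) z) | l <- enum 'I_j].
Proof.
move=> gS fP ik; rewrite tprod_pure // => [|l]; last by apply: fP; rewrite leq_ord.
have := sym_multilinear_scale (r := enum 'I_j) (u := [::])
  (fun l => (i l)`!%:R^-1) (fun l => seq_jet f x (nseq (i l) z))
  (seq_jet_sym_multilinear gS).
rewrite !cats0 size_enum_ord addn0 => -> //.
rewrite (linear_funZ _ _ (proj1 gS)).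
rewrite big_enum /= prodfV; congr (_ *: _).
rewrite -seq_jetE; congr (seq_jet g _ _); rewrite /= -map_comp -enumT.
apply: eq_map => l /=; rewrite block_nseq // -seq_jetE.
by [].
Qed.

Lemma jet_comp_diagonal (g : jet F G) (f : jet E F) x :
  (forall j, (j <= n)%N -> symmetric_linear (g j (jet0 f x))) ->
  (forall j, (j <= n)%N -> linear (f j x)) ->
  comp_diagonal n (seq_jet g (jet0 f x)) (seq_jet f x)
    (seq_jet (jet_comp n g f) x).
Proof.
move=> gS fP k z kn; have {1}-> : nseq k z = [tuple of nseq k z] by [].
rewrite seq_jetE.
pose body j : G := \sum_(i : {ffun 'I_j -> 'I_n.+1} |
             [forall l, (0 < i l)%N] && ((\sum_l i l)%N == k))
        seq_jet g (jet0 f x)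
         [seq (i l)`!%:R^-1 *: seq_jet f x (nseq (i l) z) | l <- enum 'I_j].
rewrite -(big_mkord xpredT (fun j => j`!%:R^-1 *: body j)).
have high j : (k < j)%N -> body j = 0.
  move=> kj; rewrite /body big_pred0 // => i; apply/negP => /andP[/forallP ipos /eqP ik].
  move: kj; rewrite -ik ltnNge => /negP; apply.
  rewrite -[leqLHS]card_ord -sum1_card; apply: leq_sum => l _; exact: ipos.
rewrite (big_cat_nat (n := k.+1)) //= [X in _ + X]big_nat_cond.
rewrite [X in _ + X]big1 ?addr0 => [|j /andP[/andP[kj _] _]]; last by rewrite high ?scaler0.
(* Order 0 is a separate clause of [jet_comp]; the single function on ['I_0] gives the value of
   [g]. *)
case: k kn @body high => [|k] kn body high.
  rewrite big_nat1 fact0 invr1 !scale1r /= tlift_pure; last by move=> v [].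
  rewrite /body (eq_bigl predT) => [|i]; last first.
    rewrite big_ord0 eqxx andbT.
    by have -> : [forall l, (0 < i l)%N] by apply/forallP => -[].
  rewrite (eq_bigr (fun=> jet0 g (jet0 f x))) => [|i _]; last first.
    by rewrite (size0nil (_ : size (enum 'I_0) = 0%N)) ?size_enum_ord // seq_jet0.
  by rewrite sumr_const card_ffun [#|'I_0|]card_ord expn0.
have body0 : body 0%N = 0.
  by rewrite /body big_pred0 // => i; rewrite big_ord0 andbF.
rewrite [RHS]big_ltn // body0 scaler0 add0r.
rewrite /= scaler_sumr !big_nat; apply: eq_bigr => j /andP[j0 jk].
have gj : symmetric_linear (g j (jet0 f x)) by apply: gS; rewrite (leq_trans _ kn).
rewrite scalerA mulrC -scalerA; congr (_ *: _).
rewrite -(linear_funZ _ _ (proj1 gj)) scaler_sumr (linear_fun_sum _ _ _ (proj1 gj)).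
apply: eq_bigr => i /andP[_ /eqP ik]; rewrite sum_tpermute_nseq.
have fi l : linear (f (i l) x) by apply: fP; rewrite leq_ord.
rewrite (linear_funZ _ _ (tprod_linear ik fi)).
have scaleE (c : R) (T : tpow F j) : k.+1`!%:R^-1 *: (c *: (k.+1`!%:R *: T)) = c *: T.
  by rewrite !scalerA mulrAC mulVf ?mul1r // pnatr_eq0 -lt0n fact_gt0.
by rewrite scaleE; exact: tprod_nseq.
Qed.

End CompDiagonal.

(** * Lipschitz norms and the composition theorem *)

(** Each condition on M reads c <= M * b with b >= 0 and passes to the infimum by division. If b = 0
    it does not involve M, and one admissible constant settles it. *)
Lemma lip_norm_bound (R : realType) (E F : normedModType R) (gamma : R)
    (N : tensor_norms E) (U : set E) (f : jet E F) :
  is_lip gamma N U f ->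
  0 <= lip_norm gamma N U f /\ lip_bound gamma N U f (lip_norm gamma N U f).
Proof.
move=> [_ [M0 M0P]]; rewrite /lip_norm; set S := [set M | _].
have S0 : S !=set0 by exists M0.
have infP (c b : R) : 0 <= b -> (forall M, S M -> c <= M * b) -> c <= inf S * b.
  rewrite le_eqVlt => /predU1P[<-|b0] cP; first by have := cP _ M0P; rewrite !mulr0.
  by rewrite -ler_pdivrMr //; apply: lb_le_inf => // M SM; rewrite ler_pdivrMr // cP.
split; first by apply: lb_le_inf => // M [].
move=> k kn x y Ux Uy v; split.
  by apply: infP => [|M [_ MP]]; [exact: tnorm_ge0|case: (MP k kn x y Ux Uy v)].
rewrite -mulrA; apply: infP => [|M [_ MP]].
  by rewrite mulr_ge0 ?powR_ge0 ?tnorm_ge0.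
by rewrite mulrA; case: (MP k kn x y Ux Uy v).
Qed.

(** Only an upper bound on pure tensors is asked of [N], so the lemma covers f through [cross_norm]
    and g through [projective]. *)
Lemma lip_bound_seq (R : realType) (E F : normedModType R) (gamma : R)
    (N : tensor_norms E) (U : set E) (f : jet E F) (M : R) :
  (forall k (v : k.-tuple E), N k (pure v) <= \prod_(x <- v) `|x|) ->
  (forall (k : nat) (x : E), (k <= lipfloor gamma)%N -> U x ->
     symmetric_linear (f k x)) ->
  0 <= M -> lip_bound gamma N U f M -> forall x y, U x -> U y ->
  seq_bound (lipfloor gamma) M (seq_jet f x) /\
  forall s, (size s <= lipfloor gamma)%N ->
    `|seq_remainder (lipfloor gamma) (seq_jet f x) (seq_jet f y) (x - y) s|
      <= M * `|x - y| `^ (gamma - (size s)%:R) * \prod_(x <- s) `|x|.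
Proof.
move=> NP fS M0 fM x y Ux Uy.
have bP s sn := fM (size s) sn x y Ux Uy (in_tuple s).
split=> s sn; have [b1 b2] := bP s sn.
  by apply: le_trans b1 _; rewrite ler_wpM2l ?(NP _ (in_tuple s)).
move: b2; rewrite remainder_seq // => [b2|j jn]; last by case: (fS j y jn Uy).
apply: le_trans b2 _; rewrite ler_wpM2l ?(NP _ (in_tuple s)) //.
by rewrite mulr_ge0 ?powR_ge0.
Qed.

Theorem theorem1p48 (R : realType) (gamma : R) (gamma_gt1 : 1 < gamma) :
  exists C : R,
    forall (E F G : normedModType R)
           (NE : tensor_norms E) (NF : tensor_norms F)
           (crossE : cross_norm NE)
           (projE : projective NE) (projF : projective NF)
           (U : set E) (V : set F) (f : jet E F) (g : jet F G)
           (lipf : is_lip gamma NE U f) (lipg : is_lip gamma NF V g)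
           (fUV : forall x : E, U x -> V (jet0 f x)),
      is_lip gamma NE U (jet_comp (lipfloor gamma) g f) /\
      lip_norm gamma NE U (jet_comp (lipfloor gamma) g f)
        <= C * lip_norm gamma NF V g
             * Num.max (lip_norm gamma NE U f `^ gamma) 1.
Proof.
set n := lipfloor gamma.
have g0 : 0 < gamma by apply: lt_trans gamma_gt1.
have /andP[] := lipfloorP g0; rewrite subr_gt0 -/n => ng gn.
have {}gn : gamma <= n.+1%:R by rewrite -nat1r -lerBlDr.
have n0 : (0 < n)%N.
  by rewrite lt0n; apply: contraTneq gn => ->; rewrite -ltNge.
have [C C0 CP] := seq_lip_comp n0 ng gn; exists C => E F G NE NF crossE _ projF U V f g.
move=> lipf lipg fUV.
have [M0 fM] := lip_norm_bound lipf; have [L0 gL] := lip_norm_bound lipg.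
set M := lip_norm gamma NE U f in M0 fM *; set L := lip_norm gamma NF V g in L0 gL *.
have [fS _] := lipf; have [gS _] := lipg.
have hS k x : (k <= n)%N -> U x -> symmetric_linear (jet_comp n g f (k := k) x).
  move=> kn Ux; apply: jet_comp_sym => // j jn; first by case: (gS j _ jn (fUV x Ux)).
  by case: (fS j x jn Ux).
(* The power gamma is monotone and fixes 1, so it commutes with the maximum. *)
have maxE : Num.max (M `^ gamma) 1 = Num.max M 1 `^ gamma.
  have [M1|M1] := leP M 1.
    have : M `^ gamma <= 1 `^ gamma by rewrite ge0_ler_powR ?nnegrE // ltW.
    by rewrite powR1 => /max_idPr ->.
  have : 1 `^ gamma <= M `^ gamma by rewrite ge0_ler_powR ?nnegrE // ltW.
  by rewrite powR1 => /max_idPl ->.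
set K := C * L * _; have KE : K = C * (L * Num.max M 1 `^ gamma).
  by rewrite /K maxE mulrA.
have K0 : 0 <= K by rewrite !mulr_ge0 // le_max ler01 orbT.
have hK : lip_bound gamma NE U (jet_comp n g f) K.
  move=> k kn x y Ux Uy v; rewrite remainder_seq // => [|j jn]; last first.
    by case: (hS j y jn Uy).
  rewrite -seq_jetE cross_norm_pure // KE.
  have -> : k%:R = (size v)%:R :> R by rewrite size_tuple.
  have NEP k' (w : k'.-tuple E) : NE k' (pure w) <= \prod_(x <- w) `|x|.
    by rewrite cross_norm_pure.
  have NFP k' (w : k'.-tuple F) := projective_pure w projF.
  have [Ab Ar] := lip_bound_seq NEP fS M0 fM Ux Uy.
  have [Bb _] := lip_bound_seq NEP fS M0 fM Uy Ux.
  have [Pb Pr] := lip_bound_seq NFP gS L0 gL (fUV x Ux) (fUV y Uy).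
  have [Qb _] := lip_bound_seq NFP gS L0 gL (fUV y Uy) (fUV x Ux).
  apply: (CP _ _ _ _ _ _ _ _ _ M L (x - y) M0 L0 Ab Bb Pb Qb _ _ _ _ _ Ar).
  - by move=> j jn; apply/seq_jet_sym_multilinear/fS.
  - by move=> j jn; apply/seq_jet_sym_multilinear/gS/fUV.
  - by move=> j jn; apply/seq_jet_sym_multilinear/gS/fUV.
  - by move=> j jn; apply/seq_jet_sym_multilinear/hS.
  - by move=> j jn; apply/seq_jet_sym_multilinear/hS.
  - by rewrite !seq_jet0.
  - by apply: jet_comp_diagonal => j jn; [exact/gS/fUV|case: (fS j x jn Ux)].
  - by apply: jet_comp_diagonal => j jn; [exact/gS/fUV|case: (fS j y jn Uy)].
  - by move=> /eqP; rewrite subr_eq0 => /eqP ->.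
  - by rewrite size_tuple.
split; first by split; [move=> k x; exact: hS|exists K].
by apply: ge_inf => //; exists 0 => ? [].
Qed.
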